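(* There exist a connected simply connected solvable Lie group $S$ with Lie algebra $\mathfrak{s}$ and a lattice $\Gamma$ in $S$ such that the natural transitive right action of $S$ on $\Gamma\backslash S$ by right multiplication is not parameter rigid, while $H^1(\Gamma\backslash S)=H^1(\mathfrak{s})$.
   Context: Lattices in $S$ are cocompact, so $M=\Gamma\backslash S$ is a closed manifold. $H^1(\Gamma\backslash S)$ is de Rham cohomology with real coefficients (which is the leafwise cohomology of the one-leaf orbit foliation) and $H^1(\mathfrak{s})$ is Lie algebra cohomology with trivial real coefficients. The equality means that the natural injection $H^1(\mathfrak{s})\to H^1(\Gamma\backslash S)$, regarding elements of $\bigwedge^*\mathfrak{s}^*$ as left invariant forms on $S$ and hence as forms on $\Gamma\backslash S$, is onto. A $C^\infty$ locally free right action $\rho_0$ (all isotropy subgroups discrete) of $S$ on a closed manifold $M$, with orbit foliation $\mathcal{F}$, is parameter rigid if every $C^\infty$ locally free right action $\rho$ of $S$ on $M$ whose orbit foliation coincides with $\mathcal{F}$ is parameter equivalent to $\rho_0$, i.e. there are an automorphism $\Phi$ of $S$ and a diffeomorphism $F$ of $M$ such that $F(\rho_0(x,s))=\rho(F(x),\Phi(s))$ for all $x\in M$, $s\in S$, and $F$ preserves each leaf of $\mathcal{F}$ and is $C^0$ homotopic to the identity via $C^\infty$ maps preserving each leaf. *)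

(* Defs.v *)
From HB Require Import structures.
From mathcomp Require Import all_boot all_order all_algebra generic_quotient.
From mathcomp Require Import all_classical all_reals all_analysis.

Set Implicit Arguments.
Unset Strict Implicit.
Unset Printing Implicit Defensive.

Import Order.TTheory GRing.Theory Num.Theory.
Import numFieldNormedType.Exports.

Local Open Scope classical_set_scope.
Local Open Scope ring_scope.

Section EuclideanCalculus.
Context {R : realType}.

Definition partial n (i : 'I_n) (f : 'rV[R]_n -> R) (v : 'rV[R]_n) : R :=
  'D_(delta_mx 0 i) f v.

(* Only used on open sets U: all partial derivatives of f of order at most k
   exist and are continuous at every point of U. *)
Fixpoint Ck_on n (k : nat) (U : set 'rV[R]_n) (f : 'rV[R]_n -> R) : Prop :=
  (forall v, U v -> {for v, continuous f}) /\
  match k with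
  | 0 => True
  | k'.+1 => forall i : 'I_n,
      (forall v, U v -> derivable f v (delta_mx 0 i)) /\
      Ck_on k' U (partial i f)
  end.

Definition smooth_on n m (U : set 'rV[R]_n) (f : 'rV[R]_n -> 'rV[R]_m) : Prop :=
  forall (j : 'I_m) (k : nat), Ck_on k U (fun v => f v 0 j).

(* With row vectors, the differential of f at v is w |-> w *m jacobian_mx f v. *)
Definition jacobian_mx n m (f : 'rV[R]_n -> 'rV[R]_m) (v : 'rV[R]_n) :
  'M[R]_(n, m) := \matrix_(i, j) partial i (fun u => f u 0 j) v.

Definition gradient n (f : 'rV[R]_n -> R) (v : 'rV[R]_n) : 'rV[R]_n :=
  \row_i partial i f v.

End EuclideanCalculus.

Section Manifolds.
Context {R : realType}.

(* The total functions chart_map and chart_inv are meaningful only on chart_dom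
   and on chart_img respectively. *)
Record chart (T : Type) (n : nat) := Chart {
  chart_dom : set T;
  chart_map : T -> 'rV[R]_n;
  chart_inv : 'rV[R]_n -> T }.

Definition chart_img T n (c : chart T n) : set 'rV[R]_n :=
  chart_map c @` chart_dom c.

Definition is_chart (T : topologicalType) n (c : chart T n) : Prop :=
  [/\ open (chart_dom c), open (chart_img c),
      forall x, chart_dom c x -> chart_inv c (chart_map c x) = x,
      forall x, chart_dom c x -> {for x, continuous (chart_map c)} &
      forall v, chart_img c v -> {for v, continuous (chart_inv c)}].

Definition transport T U n m (c : chart T n) (d : chart U m) (F : T -> U) :
  'rV[R]_n -> 'rV[R]_m := fun v => chart_map d (F (chart_inv c v)).

Definition transport_dom T U n m (c : chart T n) (d : chart U m) (F : T -> U) :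
  set 'rV[R]_n := chart_map c @` (chart_dom c `&` F @^-1` chart_dom d).

Definition is_smooth_manifold (T : topologicalType) n (A : set (chart T n)) :
  Prop :=
  [/\ hausdorff_space T, @second_countable T,
      forall c, A c -> is_chart c,
      forall x, exists2 c, A c & chart_dom c x &
      forall c d, A c -> A d ->
        smooth_on (transport_dom c d id) (transport c d id)].

Definition smooth_map (T U : topologicalType) n m
    (A : set (chart T n)) (B : set (chart U m)) (F : T -> U) : Prop :=
  continuous F /\
  forall c d, A c -> B d -> smooth_on (transport_dom c d F) (transport c d F).

Definition smooth_fun T n (A : set (chart T n)) (f : T -> R) : Prop :=
  forall c, A c -> forall k, Ck_on k (chart_img c) (f \o chart_inv c).

Definition diffeomorphism (T U : topologicalType) n m
    (A : set (chart T n)) (B : set (chart U m)) (F : T -> U) : Prop :=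
  smooth_map A B F /\
  exists G : U -> T, [/\ smooth_map B A G, cancel F G & cancel G F].

Definition prod_chart T U n m (c : chart T n) (d : chart U m) :
    chart (T * U) (n + m) :=
  Chart (chart_dom c `*` chart_dom d)
        (fun p => row_mx (chart_map c p.1) (chart_map d p.2))
        (fun v => (chart_inv c (lsubmx v), chart_inv d (rsubmx v))).

Definition prod_atlas T U n m (A : set (chart T n)) (B : set (chart U m)) :
    set (chart (T * U) (n + m)) :=
  [set e | exists c d, [/\ A c, B d & e = prod_chart c d]].

(* Vector fields and 1-forms are given by their components in the charts of the
   atlas: at the point of coordinates v in the chart c, the vector (resp. the
   covector) has components X c v (resp. w c v). *)
Definition components T n := chart T n -> 'rV[R]_n -> 'rV[R]_n.

(* dF(X) = Y along F. *)
Definition field_related T U n m (A : set (chart T n)) (B : set (chart U m))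
    (F : T -> U) (X : components T n) (Y : components U m) : Prop :=
  forall c d, A c -> B d -> forall v, transport_dom c d F v ->
    Y d (transport c d F v) = X c v *m jacobian_mx (transport c d F) v.

(* eta = F^* w. *)
Definition form_related T U n m (A : set (chart T n)) (B : set (chart U m))
    (F : T -> U) (eta : components T n) (w : components U m) : Prop :=
  forall c d, A c -> B d -> forall v, transport_dom c d F v ->
    eta c v = w d (transport c d F v) *m (jacobian_mx (transport c d F) v)^T.

(* Being related to itself by the identity is the change of coordinates rule.
   The components with no geometric meaning are set to 0, so that two vector
   fields are the same if and only if they are equal as functions. *)
Definition vector_field T n (A : set (chart T n)) (X : components T n) : Prop :=
  [/\ forall c, A c -> smooth_on (chart_img c) (X c),
      field_related A A id X X &
      forall c v, ~ (A c /\ chart_img c v) -> X c v = 0].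

Definition one_form T n (A : set (chart T n)) (w : components T n) : Prop :=
  (forall c, A c -> smooth_on (chart_img c) (w c)) /\ form_related A A id w w.

Definition pairing T n (w X : components T n) (c : chart T n) (v : 'rV[R]_n) :
  R := \sum_i w c v 0 i * X c v 0 i.

Definition closed_form T n (A : set (chart T n)) (w : components T n) : Prop :=
  forall c, A c -> forall v, chart_img c v -> forall i j : 'I_n,
    partial i (fun u => w c u 0 j) v = partial j (fun u => w c u 0 i) v.

Definition cohomologous T n (A : set (chart T n)) (w w' : components T n) :
    Prop :=
  exists2 f : T -> R, smooth_fun A f &
    forall c, A c -> forall v, chart_img c v ->
      w c v = w' c v + gradient (f \o chart_inv c) v.

Definition bracket T n (X Y : components T n) : components T n :=
  fun c v => X c v *m jacobian_mx (Y c) v - Y c v *m jacobian_mx (X c) v.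

Definition simply_connected (T : topologicalType) : Prop :=
  forall g : R -> T, {within `[0, 1], continuous g} -> g 0 = g 1 ->
  exists H : R * R -> T,
    [/\ {within `[0, 1] `*` `[0, 1], continuous H},
        forall t : R, 0 <= t <= 1 -> H (0, t) = g t,
        forall t : R, 0 <= t <= 1 -> H (1, t) = g 0 &
        forall s : R, 0 <= s <= 1 -> H (s, 0) = g 0 /\ H (s, 1) = g 0].

End Manifolds.

Arguments chart R T n : clear implicits.
Arguments components R T n : clear implicits.
Arguments simply_connected R T : clear implicits.

#[short(type="groupSpaceType")]
HB.structure Definition GroupSpace := {G of Group G & Topological G}.

Record lieGroup (R : realType) := LieGroup {
  lie_sort :> groupSpaceType;
  lie_dim : nat;
  lie_atlas : set (chart R lie_sort lie_dim);
  lie_manifold : is_smooth_manifold lie_atlas;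
  lie_smooth_mul : smooth_map (prod_atlas lie_atlas lie_atlas) lie_atlas
    (fun p : lie_sort * lie_sort => (p.1 * p.2)%g);
  lie_smooth_inv : smooth_map lie_atlas lie_atlas
    (fun x : lie_sort => (x^-1)%g) }.

Arguments lie_atlas {R} S : rename.

Section Groups.
Local Open Scope group_scope.

Record subgroup (G : groupType) := Subgroup {
  subgroup_set :> set G;
  subgroup1 : subgroup_set 1;
  subgroupM : forall x y,
    subgroup_set x -> subgroup_set y -> subgroup_set (x * y);
  subgroupV : forall x, subgroup_set x -> subgroup_set x^-1 }.

Definition generated (G : groupType) (A : set G) : set G :=
  [set x | forall H : subgroup G, A `<=` H -> subgroup_set H x].

Fixpoint derived_subgroup {G : groupType} (k : nat) : set G :=
  match k with
  | 0 => setT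
  | k'.+1 => generated
      [set z | exists x y : G,
         [/\ derived_subgroup k' x, derived_subgroup k' y & z = commg x y]]
  end.

Definition solvable_group (G : groupType) : Prop :=
  exists k, derived_subgroup k = [set (1 : G)].

(* Gamma x = Gamma y *)
Definition coset_rel (G : groupType) (Gamma : subgroup G) : rel G :=
  fun x y => `[< subgroup_set Gamma (x * y^-1) >].

Lemma coset_rel_equiv (G : groupType) (Gamma : subgroup G) :
  equiv_class_of (coset_rel Gamma).
Proof.
split=> [x|x y|y x z]; rewrite /coset_rel.
- by apply/asboolP; rewrite mulgV; exact: subgroup1.
- by apply/asboolP/asboolP => /subgroupV; rewrite invgM invgK.
- move=> /asboolP xy /asboolP yz; apply/asboolP.
  by have := subgroupM xy yz; rewrite mulgA mulgVK.
Qed.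

Definition coset_equiv (G : groupType) (Gamma : subgroup G) : equiv_rel G :=
  EquivRelPack (coset_rel_equiv Gamma).

(* The space Gamma \ G with the quotient topology. *)
Definition coset_space (G : groupSpaceType) (Gamma : subgroup G) : Type :=
  quotient_topology {eq_quot coset_equiv Gamma}%qT.

HB.instance Definition _ (G : groupSpaceType) (Gamma : subgroup G) :=
  Topological.on (coset_space Gamma).
HB.instance Definition _ (G : groupSpaceType) (Gamma : subgroup G) :=
  Quotient.on (coset_space Gamma).

Definition coset_proj (G : groupSpaceType) (Gamma : subgroup G) (x : G) :
  coset_space Gamma := \pi_(coset_space Gamma)%qT x.

HB.instance Definition _ (G : groupSpaceType) (Gamma : subgroup G) :=
  isPointed.Build (coset_space Gamma) (coset_proj Gamma 1).

(* (Gamma x) . s = Gamma (x s) *)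
Definition coset_act (G : groupSpaceType) (Gamma : subgroup G)
    (m : coset_space Gamma) (s : G) : coset_space Gamma :=
  coset_proj Gamma (repr m * s).

Lemma coset_actE (G : groupSpaceType) (Gamma : subgroup G) (x s : G) :
  coset_act (coset_proj Gamma x) s = coset_proj Gamma (x * s).
Proof.
apply/eqmodP/asboolP; rewrite invgM mulgA mulgK.
have : repr (coset_proj Gamma x) = x %[mod coset_space Gamma]%qT by rewrite reprK.
by move/eqmodP/asboolP.
Qed.

Definition is_discrete (T : topologicalType) (A : set T) : Prop :=
  A `<=` isolated A.

Definition borel (T : ptopologicalType) := g_sigma_algebraType (@open T).

(* A discrete subgroup such that Gamma \ G carries a nonzero finite Borel
   measure invariant under right translations. *)
Definition is_lattice (R : realType) (G : groupSpaceType) (Gamma : subgroup G) :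
    Prop :=
  is_discrete Gamma /\
  exists mu : {finite_measure set (borel (coset_space Gamma)) -> \bar R},
    (0%R < mu setT)%E /\
    forall (s : G) (A : set (borel (coset_space Gamma))), measurable A ->
      mu ((fun m : coset_space Gamma => coset_act m s) @^-1` A) = mu A.

End Groups.

Section Actions.
Context {R : realType} (S : lieGroup R).
Local Open Scope group_scope.

Definition right_action (M : Type) (rho : M -> S -> M) : Prop :=
  (forall x, rho x 1 = x) /\
  (forall x s t, rho (rho x s) t = rho x (s * t)).

Definition orbit (M : Type) (rho : M -> S -> M) (x : M) : set M :=
  range (rho x).

Definition smooth_locally_free_action (M : topologicalType) m
    (A : set (chart R M m)) (rho : M -> S -> M) : Prop :=
  [/\ right_action rho,
      smooth_map (prod_atlas A (lie_atlas S)) A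
        (fun p : M * S => rho p.1 p.2) &
      forall x, is_discrete [set s | rho x s = x]].

Definition lie_automorphism (Phi : S -> S) : Prop :=
  diffeomorphism (lie_atlas S) (lie_atlas S) Phi /\ {morph Phi : x y / x * y}.

Definition leaf_preserving (M : Type) (rho : M -> S -> M) (F : M -> M) : Prop :=
  forall x, orbit rho x (F x).

Definition leafwise_homotopic_id (M : topologicalType) m
    (A : set (chart R M m)) (rho : M -> S -> M) (F : M -> M) : Prop :=
  exists H : R * M -> M,
    [/\ {within `[0%R, 1%R] `*` setT, continuous H},
        forall x, H (0%R, x) = x,
        forall x, H (1%R, x) = F x &
        forall t : R, (0 <= t <= 1)%R ->
          smooth_map A A (fun x => H (t, x)) /\
          leaf_preserving rho (fun x => H (t, x))].

Definition parameter_equivalent (M : topologicalType) m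
    (A : set (chart R M m)) (rho0 rho : M -> S -> M) : Prop :=
  exists (Phi : S -> S) (F : M -> M),
    [/\ lie_automorphism Phi, diffeomorphism A A F,
        forall x s, F (rho0 x s) = rho (F x) (Phi s),
        leaf_preserving rho0 F &
        leafwise_homotopic_id A rho0 F].

(* S is connected in the applications, so the leaves of the orbit foliation are
   the orbits, and two orbit foliations coincide when they have the same
   leaves. *)
Definition parameter_rigid (M : topologicalType) m (A : set (chart R M m))
    (rho0 : M -> S -> M) : Prop :=
  forall rho : M -> S -> M, smooth_locally_free_action A rho ->
    (forall x, orbit rho x = orbit rho0 x) ->
    parameter_equivalent A rho0 rho.

End Actions.

Section CosetManifold.
Context {R : realType} (S : lieGroup R) (Gamma : subgroup S).
Local Open Scope group_scope.

(* The charts of Gamma \ S are the charts of S pushed forward by the projection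
   on open sets where it is injective. *)
Definition coset_atlas : set (chart R (coset_space Gamma) (lie_dim S)) :=
  [set d | exists (c : chart R S (lie_dim S)) (V : set S),
     [/\ lie_atlas S c /\ V `<=` chart_dom c,
         open V,
         forall x y, V x -> V y ->
           coset_proj Gamma x = coset_proj Gamma y -> x = y,
         chart_dom d = coset_proj Gamma @` V &
         forall x, V x ->
           chart_map d (coset_proj Gamma x) = chart_map c x /\
           chart_inv d (chart_map c x) = coset_proj Gamma x]].

Definition lie_algebra : set (components R S (lie_dim S)) :=
  [set X | vector_field (lie_atlas S) X /\
     forall g : S,
       field_related (lie_atlas S) (lie_atlas S) (fun x => g * x) X X].

(* A 1-cocycle of the Lie algebra with trivial real coefficients. All
   1-coboundaries are zero, so H^1 of the Lie algebra is the space of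
   1-cocycles. *)
Definition lie_cocycle (alpha : components R S (lie_dim S) -> R) : Prop :=
  (forall (a : R) X Y, lie_algebra X -> lie_algebra Y ->
     alpha (fun c v => a *: X c v + Y c v)%R = (a * alpha X + alpha Y)%R) /\
  (forall X Y, lie_algebra X -> lie_algebra Y -> alpha (bracket X Y) = 0%R).

(* eta is alpha regarded as a left invariant form on S. *)
Definition invariant_form_of (alpha : components R S (lie_dim S) -> R)
    (eta : components R S (lie_dim S)) : Prop :=
  one_form (lie_atlas S) eta /\
  forall X, lie_algebra X -> forall c, lie_atlas S c -> forall v, chart_img c v ->
    pairing eta X c v = alpha X.

(* H^1(Gamma \ S) = H^1(s): every closed 1-form on Gamma \ S is cohomologous to
   a form whose pullback to S is the left invariant form of a cocycle. *)
Definition H1_coset_eq_H1_lie : Prop :=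
  forall w, one_form coset_atlas w -> closed_form coset_atlas w ->
  exists alpha eta w',
    [/\ lie_cocycle alpha,
        invariant_form_of alpha eta,
        one_form coset_atlas w',
        form_related (lie_atlas S) coset_atlas (coset_proj Gamma) eta w' &
        cohomologous coset_atlas w w'].

End CosetManifold.

Arguments coset_atlas {R S} Gamma.

(* Main.v *)
(** Let S be the product R x C with (t, z) (t', z') = (t + t', z + exp(i pi t) z')
    and let Gamma be its subgroup Z x Z[i]. The element (2, 0) is central and lies
    in Gamma, so it acts trivially on Gamma \ S. The formula
    Gamma (t, z) . (t', z') = Gamma (t + t'/3, z + exp(3 i pi t) z') defines another
    transitive locally free action, for which the centre does not act trivially;
    as an automorphism of S preserves the centre, the two actions are not
    parameter equivalent.

    A closed 1-form on Gamma \ S lifts to dF on R^3 by the Poincare lemma, and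
    F (g x) - F x is a homomorphism from Gamma to R. It vanishes on Gamma /\ C,
    because conjugation by (1, 0) is z |-> -z there, so it is the restriction of
    (t, z) |-> l t. Hence F - l t descends to Gamma \ S, and the form is
    cohomologous to the left invariant form l dt. *)

(* The dilation (t, z) |-> (3t, z) turns the competing action into right multiplication on Gamma' \
   S, where Gamma' = 3Z x Z[i]. Since exp(3 i pi k) = exp(i pi k) for every integer k, the dilation
   restricts to an isomorphism from Gamma onto Gamma'. This isomorphism does not extend to an
   automorphism of S, which would have to preserve the centre 2Z x 0. Any odd p >= 3 paired with a =
   1/p would serve as well: p must be odd for the formula to descend to Gamma \ S, a p = 1 makes it
   an action, and 2/p must not be an integer.

   The Lie algebra of S has trivial centre, so what separates the two actions is a discrete group
   that it does not see; this is why H^1, a line spanned by dt on both sides, gives no warning.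

   Left translations by Gamma are affine with diagonal linear part, whose entries are 1 or -1, and
   every change of coordinates on Gamma \ S is locally one of them. Calculations in charts are
   thereby replaced by global formulas on R^3. *)
From HB Require Import structures.
Require Import Defs.
From mathcomp Require Import all_boot all_order all_algebra generic_quotient.
From mathcomp Require Import all_classical all_reals all_analysis.
From mathcomp Require Import measurable_realfun ring lra.

Set Implicit Arguments.
Unset Strict Implicit.
Unset Printing Implicit Defensive.

Import Order.TTheory GRing.Theory Num.Theory.
Import numFieldNormedType.Exports.

Local Open Scope classical_set_scope.
Local Open Scope ring_scope.

(** * Smooth functions on Euclidean space *)

Section Calculus.
Context {R : realType}.

Lemma continuous_near_eq (T U : topologicalType) (f g : T -> U) (v : T) :
  (\near v, f v = g v) -> {for v, continuous g} -> {for v, continuous f}.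
Proof.
rewrite /prop_for /continuous_at => fg cg; rewrite (nbhs_singleton fg).
apply: cvg_trans cg; apply: near_eq_cvg.
by apply: filterS fg => u /= ->.
Qed.

(** Regularity is local, and [W] and [g] may vary with the point: a map read in charts can be
    compared near each point with a formula that is smooth on the whole space. *)
Lemma Ck_on_loc n k (U : set 'rV[R]_n) (f : 'rV[R]_n -> R) :
  (forall v, U v -> exists W g, [/\ W v, Ck_on k W g & \near v, f v = g v]) ->
  Ck_on k U f.
Proof.
elim: k U f => [|k IH] U f loc; split=> //.
- move=> v /loc[W [g [Wv [cg _] fg]]].
  exact: continuous_near_eq fg (cg v Wv).
- move=> v /loc[W [g [Wv [cg _] fg]]].
  exact: continuous_near_eq fg (cg v Wv).
- move=> i; split=> [v Uv|].
    have [W [g [Wv [_ Wg] fg]]] := loc v Uv.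
    have [dg _] := Wg i; apply: near_eq_derivable (dg v Wv).
    by apply: filterS fg => u /= ->.
  apply: IH => v Uv; have [W [g [Wv [_ Wg] fg]]] := loc v Uv.
  exists W, (partial i g); split=> //; first by have [] := Wg i.
  (* Equality near [v] is equality near every [u] close to [v], so the partial derivatives also
     agree near [v]. *)
  have := near_join fg; apply: filterS => u; exact: near_eq_derive.
Qed.

Lemma Ck_onS n k (U V : set 'rV[R]_n) f : V `<=` U -> Ck_on k U f -> Ck_on k V f.
Proof.
move=> VU Uf; apply: Ck_on_loc => v /VU Uv; exists U, f; split=> //.
exact: (@filterE _ (nbhs v)).
Qed.

Lemma Ck_on_le n k (U : set 'rV[R]_n) f : Ck_on k.+1 U f -> Ck_on k U f.
Proof.
elim: k f => [|k IH] f [cf df]; split=> // i.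
by have [dfi Cf] := df i; split=> //; exact: IH.
Qed.

(** Reduces directional derivatives to derivatives in one real variable, where the chain rule and
    integration theorems apply. *)
Lemma is_derive_along (V W : normedModType R) (f : V -> W) (v w : V) (d : W) :
  is_derive v w f d <-> is_derive (0 : R) 1 (fun h => f (h *: w + v)) d.
Proof.
have E : 'D_w f v = 'D_1 (fun h : R => f (h *: w + v)) 0.
  rewrite /derive; set g1 := fun h => h^-1 *: _; set g2 := fun h => h^-1 *: _.
  suff -> : g1 = g2 by [].
  by apply/funext => h; rewrite /g1 /g2 /= addr0 scale0r add0r [_%:A]mulr1.
split=> -[df <-].
  have {}df := (derivable1P f v w).1 df.
  exact: (DeriveDef df (esym E)).
have {}df := (derivable1P f v w).2 df.
exact: (DeriveDef df E).
Qed.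

Lemma is_derive_coord n (j : 'I_n) (w v : 'rV[R]_n) :
  is_derive v w (fun u : 'rV[R]_n => u 0 j) (w 0 j).
Proof.
refine (proj2 (@is_derive_along _ R _ _ _ _) _).
rewrite (_ : (fun h => _) = (id * cst (w 0 j) + cst (v 0 j) : R -> R)); last first.
  by apply/funext => h; rewrite !mxE.
apply: is_derive_eq.
by rewrite scaler0 add0r addr0 [LHS]mulr1.
Qed.

Lemma is_derive_comp_dir (V : normedModType R) (f : V -> R) (g : R -> R)
    (v w : V) (df dg : R) :
  is_derive v w f df -> is_derive (f v) 1 g dg ->
  is_derive v w (g \o f) (dg * df).
Proof.
move=> /is_derive_along f' g'.
refine (proj2 (@is_derive_along _ R _ _ _ _) _).
apply: (is_derive1_comp (f := g) (g := fun h => f (h *: w + v))) => //.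
by rewrite scale0r add0r.
Qed.

Definition smoothf n (f : 'rV[R]_n -> R) := forall k, Ck_on k setT f.

Lemma Ck_onS_is_derive n k (f : 'rV[R]_n -> R) (df : 'I_n -> 'rV[R]_n -> R) :
  continuous f -> (forall i v, is_derive v (delta_mx 0 i) f (df i v)) ->
  (forall i, Ck_on k setT (df i)) -> Ck_on k.+1 setT f.
Proof.
move=> cf f' Cdf; split=> [v _|i]; first exact: cf.
split=> [v _|]; first exact: ex_derive.
rewrite (_ : partial i f = df i) //.
by apply/funext => v; rewrite /partial derive_val.
Qed.

Lemma Ck_on_is_derive n k (f : 'rV[R]_n -> R) :
  Ck_on k.+1 setT f -> forall i v, is_derive v (delta_mx 0 i) f (partial i f v).
Proof. by move=> [_ +] i v => /(_ i)[+ _] => /(_ v I)/derivableP. Qed.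

Lemma Ck_on_continuous n k (f : 'rV[R]_n -> R) : Ck_on k setT f -> continuous f.
Proof. by case: k => [|k] [cf _] v; exact: cf. Qed.

Lemma smooth_partial n (f : 'rV[R]_n -> R) i : smoothf f -> smoothf (partial i f).
Proof. by move=> sf k; have [_ /(_ i)[]] := sf k.+1. Qed.

Lemma smooth_cst n (a : R) : smoothf (fun _ : 'rV[R]_n => a).
Proof.
have ca : continuous (fun _ : 'rV[R]_n => a) by exact: cst_continuous.
move=> k; elim: k a ca => [|k IH] a ca; first by split=> // v _; exact: ca.
apply: (@Ck_onS_is_derive _ _ _ (fun _ _ => 0)) => // i.
apply: IH; exact: cst_continuous.
Qed.

Lemma smooth_coord n (j : 'I_n) : smoothf (fun u : 'rV[R]_n => u 0 j).
Proof.
move=> [|k]; first by split=> // v _; exact: coord_continuous.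
apply: (@Ck_onS_is_derive _ _ _ (fun i v => (delta_mx 0 i : 'rV[R]_n) 0 j)).
- exact: coord_continuous.
- move=> i v; exact: is_derive_coord.
- by move=> i; exact: smooth_cst.
Qed.

Lemma smooth_lsubmx m n (j : 'I_m) :
  smoothf (fun v : 'rV[R]_(m + n) => lsubmx v 0 j).
Proof.
rewrite (_ : (fun v => _) = (fun v : 'rV[R]_(m + n) => v 0 (lshift n j))).
  exact: smooth_coord.
by apply/funext => v; rewrite mxE.
Qed.

Lemma smooth_rsubmx m n (j : 'I_n) :
  smoothf (fun v : 'rV[R]_(m + n) => rsubmx v 0 j).
Proof.
rewrite (_ : (fun v => _) = (fun v : 'rV[R]_(m + n) => v 0 (rshift m j))).
  exact: smooth_coord.
by apply/funext => v; rewrite mxE.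
Qed.

Lemma Ck_onD n k (f g : 'rV[R]_n -> R) : Ck_on k setT f -> Ck_on k setT g ->
  Ck_on k setT (fun v => f v + g v).
Proof.
elim: k f g => [|k IH] f g Cf Cg;
  have cf := Ck_on_continuous Cf; have cg := Ck_on_continuous Cg;
  have cfg : continuous (fun v => f v + g v).
- move=> v; exact: (cvgD (cf v) (cg v)).
- by split=> // v _; exact: cfg.
- move=> v; exact: (cvgD (cf v) (cg v)).
apply: (@Ck_onS_is_derive _ _ _ (fun i v => partial i f v + partial i g v)).
- exact: cfg.
- move=> i v; have df := Ck_on_is_derive Cf i v; have dg := Ck_on_is_derive Cg i v.
  exact: is_deriveD df dg.
- by move=> i; case: Cf => _ /(_ i)[_ ?]; case: Cg => _ /(_ i)[_ ?]; exact: IH.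
Qed.

Lemma Ck_onM n k (f g : 'rV[R]_n -> R) : Ck_on k setT f -> Ck_on k setT g ->
  Ck_on k setT (fun v => f v * g v).
Proof.
elim: k f g => [|k IH] f g Cf Cg;
  have cf := Ck_on_continuous Cf; have cg := Ck_on_continuous Cg;
  have cfg : continuous (fun v => f v * g v).
- move=> v; exact: (cvgM (cf v) (cg v)).
- by split=> // v _; exact: cfg.
- move=> v; exact: (cvgM (cf v) (cg v)).
apply: (@Ck_onS_is_derive _ _ _
  (fun i v => f v * partial i g v + g v * partial i f v)).
- exact: cfg.
- move=> i v; have df := Ck_on_is_derive Cf i v; have dg := Ck_on_is_derive Cg i v.
  exact: is_deriveM df dg.
- move=> i; have [_ /(_ i)[_ Cf']] := Cf; have [_ /(_ i)[_ Cg']] := Cg.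
  by apply: Ck_onD; apply: IH => //; exact: Ck_on_le.
Qed.

(** The two statements are proved together because the derivative of each function involves the
    other. *)
Lemma Ck_on_cos_sin n k (f : 'rV[R]_n -> R) : Ck_on k setT f ->
  Ck_on k setT (fun v => cos (f v)) /\ Ck_on k setT (fun v => sin (f v)).
Proof.
elim: k f => [|k IH] f Cf.
  have cf := Ck_on_continuous Cf; split; split=> // v _.
    exact: continuous_comp (cf v) (@continuous_cos R _).
  exact: continuous_comp (cf v) (@continuous_sin R _).
have cf := Ck_on_continuous Cf.
have [Cc Cs] := IH f (Ck_on_le Cf).
split.
- apply: (@Ck_onS_is_derive _ _ _ (fun i v => (-1 * sin (f v)) * partial i f v)).
  + by move=> v; exact: continuous_comp (cf v) (@continuous_cos R _).
  + move=> i v; rewrite mulN1r; have df := Ck_on_is_derive Cf i v.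
    exact: is_derive_comp_dir df (is_derive_cos _).
  + move=> i; apply: Ck_onM; first by apply: Ck_onM => //; exact: smooth_cst.
    by have [_ /(_ i)[]] := Cf.
- apply: (@Ck_onS_is_derive _ _ _ (fun i v => cos (f v) * partial i f v)).
  + by move=> v; exact: continuous_comp (cf v) (@continuous_sin R _).
  + move=> i v; have df := Ck_on_is_derive Cf i v.
    exact: is_derive_comp_dir df (is_derive_sin _).
  + by move=> i; apply: Ck_onM => //; have [_ /(_ i)[]] := Cf.
Qed.

Lemma smoothD n (f g : 'rV[R]_n -> R) : smoothf f -> smoothf g ->
  smoothf (fun v => f v + g v).
Proof. by move=> sf sg k; exact: Ck_onD. Qed.

Lemma smoothM n (f g : 'rV[R]_n -> R) : smoothf f -> smoothf g ->
  smoothf (fun v => f v * g v).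
Proof. by move=> sf sg k; exact: Ck_onM. Qed.

Lemma smoothN n (f : 'rV[R]_n -> R) : smoothf f -> smoothf (fun v => - f v).
Proof.
move=> sf; rewrite (_ : (fun v => _) = (fun v => -1 * f v)).
  by apply: smoothM => //; exact: smooth_cst.
by apply/funext => v; rewrite mulN1r.
Qed.

Lemma smooth_cos n (f : 'rV[R]_n -> R) : smoothf f -> smoothf (fun v => cos (f v)).
Proof. by move=> sf k; have [] := Ck_on_cos_sin (sf k). Qed.

Lemma smooth_sin n (f : 'rV[R]_n -> R) : smoothf f -> smoothf (fun v => sin (f v)).
Proof. by move=> sf k; have [] := Ck_on_cos_sin (sf k). Qed.

Lemma cvg_rV (T : Type) (F : set_system T) {FF : Filter F} n
    (f : T -> 'rV[R]_n) (l : 'rV[R]_n) :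
  (forall j, f x 0 j @[x --> F] --> l 0 j) -> f x @[x --> F] --> l.
Proof.
move=> fl A [P lP PA].
have : \forall x \near F, forall j, P 0 j (f x 0 j).
  by apply: filter_forall => j; exact: (fl j _ (lP 0 j)).
by apply: filterS => x Px; apply: PA => i j; rewrite ord1; exact: Px.
Qed.

Lemma smooth_continuous n m (f : 'rV[R]_n -> 'rV[R]_m) :
  (forall j, smoothf (fun v => f v 0 j)) -> continuous f.
Proof.
move=> sf v; apply: (@cvg_rV _ (nbhs v)) => j; exact: (Ck_on_continuous (sf j 0%N)).
Qed.

End Calculus.

Arguments Ck_on_continuous {R n k f} _.
Arguments smooth_continuous {R n m f} _.

(** * Functions with continuous partial derivatives *)

Section ContinuousPartials.
Context {R : realType}.

Lemma is_derive_line (V W : normedModType R) (f : V -> W) (v w : V) (s : R) d :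
  is_derive (s *: w + v) w f d <-> is_derive s 1 (fun r => f (r *: w + v)) d.
Proof.
have E : (fun h : R => f (h *: w + (s *: w + v))) =
    (fun h : R => f ((h *: (1 : R) + s) *: w + v)).
  by apply/funext => h; rewrite addrA -scalerDl [_%:A]mulr1.
have L := is_derive_along f (s *: w + v) w d.
have L1 := @is_derive_along _ R W (fun r => f (r *: w + v)) s 1 d.
by split=> H; [apply: L1.2; rewrite -E; exact: L.1|
  apply: L.2; rewrite E; exact: L1.1].
Qed.

(** Subtracting the linear term [s * d] first makes the mean value theorem produce the error
    directly. *)
Lemma mvt_line (V : normedModType R) (f df : V -> R) (u e : V) (d eps t : R) :
  (forall v, is_derive v e f (df v)) ->
  (forall s, `|s| <= `|t| -> `|df (s *: e + u) - d| <= eps) ->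
  `|f (t *: e + u) - f u - t * d| <= `|t| * eps.
Proof.
move=> f' dfe; pose g s := f (s *: e + u) - s * d.
have g' (s : R) : is_derive s (1 : R) g (df (s *: e + u) - d).
  have f's := (is_derive_line f u e s _).1 (f' _).
  have l's : is_derive s (1 : R) (fun r : R => r * d) d.
    rewrite (_ : (fun r => _) = (id * cst d : R -> R))//.
    by apply: is_derive_eq; rewrite scaler0 add0r [LHS]mulr1.
  exact: is_deriveB.
have gc (A : set R) : {within A, continuous g}.
  apply: continuous_subspaceT => s; apply/differentiable_continuous.
  exact/derivable1_diffP.
have -> : f (t *: e + u) - f u - t * d = g t - g 0.
  by rewrite /g scale0r mul0r add0r subr0 addrAC.
have [t0|t0] := leP 0 t.
  have [c /andP[c0 ct] ->] := MVT_segment t0 (fun x _ => g' x) (gc _).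
  rewrite subr0 normrM mulrC ler_wpM2l// dfe//.
  by rewrite !ger0_norm// (le_trans c0).
have [c /andP[tc c0] E] := MVT_segment (ltW t0) (fun x _ => g' x) (gc _).
rewrite distrC E sub0r normrM normrN mulrC ler_wpM2l// dfe//.
by rewrite (ler0_norm c0) (ltr0_norm t0) lerN2.
Qed.

Variables (n : nat) (f : 'rV[R]_n -> R) (df : 'I_n -> 'rV[R]_n -> R).
Hypothesis f' : forall i v, is_derive v (delta_mx 0 i) f (df i v).

(** The path from [v] to [h + v] changes one coordinate at a time, with [mvt_line] on each edge; all
    its points stay in the coordinate box given by [h], where the bound on [df] is assumed. *)
Lemma partials_estimate (v h : 'rV[R]_n) (eps : R) :
  (forall u : 'rV[R]_n, (forall j, `|u 0 j - v 0 j| <= `|h 0 j|) ->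
    forall i, `|df i u - df i v| <= eps) ->
  `|f (h + v) - f v - \sum_i h 0 i * df i v| <= (\sum_i `|h 0 i|) * eps.
Proof.
move=> dfe; pose h_ k : 'rV[R]_n := \row_(j < n) if (j < k)%N then h 0 j else 0.
suff H k : (k <= n)%N ->
    `|f (h_ k + v) - f v - \sum_(i < n | (i < k)%N) h 0 i * df i v| <=
    (\sum_(i < n | (i < k)%N) `|h 0 i|) * eps.
  have := H n (leqnn n).
  have -> : h_ n = h by apply/rowP => j; rewrite !mxE ltn_ord.
  have allE (V : nmodType) (F : 'I_n -> V) :
      \sum_(i < n | (i < n)%N) F i = \sum_i F i.
    by apply: eq_bigl => i; rewrite ltn_ord.
  by rewrite !allE.
elim: k => [_|k IH kn].
  rewrite !big_pred0// mul0r subr0 (_ : h_ 0 = 0) ?add0r ?subrr ?normr0//.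
  by apply/rowP => j; rewrite !mxE.
pose k' := Ordinal kn.
have split_sum (V : nmodType) (F : 'I_n -> V) :
    \sum_(i < n | (i < k.+1)%N) F i = F k' + \sum_(i < n | (i < k)%N) F i.
  rewrite (bigD1 k') ?ltnS//=; congr (_ + _); apply: eq_bigl => i.
  by rewrite ltnS -val_eqE /= andbC ltn_neqAle.
have hS : h_ k.+1 = h 0 k' *: delta_mx 0 k' + h_ k.
  apply/rowP => j; rewrite !mxE eqxx /= ltnS leq_eqVlt.
  have [->|jk] := eqVneq j k'; first by rewrite /= eqxx ltnn mulr1 addr0.
  by rewrite -val_eqE /= in jk; rewrite (negbTE jk) /= mulr0 add0r.
rewrite !split_sum mulrDl.
have := @mvt_line _ f (df k') (h_ k + v) (delta_mx 0 k') (df k' v) eps (h 0 k') (f' k').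
rewrite addrA -hS => /(_ _)/le_trans => M.
have {}M : `|f (h_ k.+1 + v) - f (h_ k + v) - h 0 k' * df k' v| <= `|h 0 k'| * eps.
  apply: M => // s sh; apply: dfe => j; rewrite !mxE eqxx /=.
  have [->|jk] := eqVneq j k'.
    by rewrite /= ltnn add0r mulr1 addrK.
  by rewrite mulr0 add0r addrK; case: ifP; rewrite ?normr0.
apply: le_trans (lerD M (IH (ltnW kn))); apply: le_trans (ler_normD _ _).
rewrite le_eqVlt; apply/orP; left; apply/eqP; congr `|_|.
by rewrite opprD; ring.
Qed.

Hypothesis cdf : forall i, continuous (df i).

Lemma partials_near (v : 'rV[R]_n) (eps : R) : 0 < eps -> exists2 d, 0 < d &
  forall u : 'rV[R]_n, (forall j, `|u 0 j - v 0 j| < d) ->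
    forall i, `|df i u - df i v| <= eps.
Proof.
move=> e0; have : \forall u \near v, forall i, `|df i u - df i v| <= eps.
  have nbi i : \forall u \near v, `|df i u - df i v| <= eps.
    have ci : df i u @[u --> v] --> df i v by exact: cdf.
    by have /cvgrPdist_le/(_ _ e0) := ci; apply: filterS => u; rewrite distrC.
  exact: (filter_forall _ nbi).
move=> /nbhs_ballP[d /= d0 vd]; exists d => // u ud; apply: vd; split=> // i j.
by rewrite ord1 /ball/= distrC.
Qed.

(** Continuous partial derivatives give a derivative in every direction. Radial directions are
    needed for the Poincare lemma, and for showing that a function with zero partial derivatives is
    constant. *)
Lemma is_derive_partials v w : is_derive v w f (\sum_i w 0 i * df i v).
Proof.
set d := \sum_i _; set W := \sum_i `|w 0 i|.
have W0 : 0 <= W by exact: sumr_ge0.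
have cv : h^-1 *: ((f \o shift v) (h *: w) - f v) @[h --> 0^'] --> d.
  apply/cvgrPdist_le => e e0.
  (* The added 1 keeps the denominator positive when [w] is zero. *)
  have eW : 0 < e / (W + 1) by rewrite divr_gt0// ltr_wpDl.
  have [r r0 vr] := partials_near v eW.
  have rW : 0 < r / (W + 1) by rewrite divr_gt0// ltr_wpDl.
  near=> t.
  have t0 : t != 0 by near: t; exact: nbhs_dnbhs_neq.
  have tr : `|t| * (W + 1) < r.
    by rewrite -ltr_pdivlMr ?ltr_wpDl//; near: t; exact: dnbhs0_lt.
  have wW j : `|w 0 j| <= W by rewrite /W (bigD1 j)//= lerDl sumr_ge0.
  have := @partials_estimate v (t *: w) (e / (W + 1)).
  have -> : \sum_i (t *: w) 0 i * df i v = t * d.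
    by rewrite mulr_sumr; apply: eq_bigr => i _; rewrite mxE mulrA.
  have -> : \sum_i `|(t *: w) 0 i| = `|t| * W.
    by rewrite mulr_sumr; apply: eq_bigr => i _; rewrite mxE normrM.
  move=> E; rewrite distrC.
  have -> : t^-1 *: ((f \o shift v) (t *: w) - f v) - d =
      t^-1 * (f (t *: w + v) - f v - t * d).
    by rewrite mulrBr mulrA mulVf// mul1r.
  rewrite normrM normfV ler_pdivrMl ?normr_gt0//; apply: le_trans (E _) _.
    move=> u uv; apply: vr => j; apply: le_lt_trans (uv j) _.
    rewrite mxE normrM; apply: le_lt_trans tr.
    by rewrite ler_wpM2l// (le_trans (wW j))// lerDl.
  rewrite -mulrA ler_wpM2l// mulrCA ler_piMr ?ltW//.
  by rewrite ltr_pdivrMr ?ltr_wpDl// mul1r ltrDl.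
by apply: DeriveDef; [apply/cvg_ex; exists d|exact/cvg_lim].
Unshelve. all: by end_near. Qed.

Lemma partials_continuous : continuous f.
Proof.
move=> v; apply: (proj2 (@cvgrPdist_lt _ _ _ (nbhs v) _ f (f v))) => e e0.
(* [|df i v|] bounds the linear part and the 1 bounds the error in [partials_estimate], so [D] is a
   Lipschitz constant at [v]. *)
set D := \sum_i (`|df i v| + 1).
have D0 : 0 <= D by apply: sumr_ge0 => i _; rewrite addr_ge0.
have [r r0 vr] := partials_near v ltr01.
have eD : 0 < e / (D + 1) by rewrite divr_gt0// ltr_wpDl.
near=> u.
have uv j : `|(u - v) 0 j| < Num.min r (e / (D + 1)).
  rewrite !mxE distrC; move: j; near: u; apply/nbhs_ballP.
  by exists (Num.min r (e / (D + 1))) => [|u [_ +] j]; [rewrite /= lt_min r0|exact].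
have := @partials_estimate v (u - v) 1; rewrite subrK => /(_ _) E.
rewrite distrC.
have {}E : `|f u - f v - \sum_i (u - v) 0 i * df i v| <= \sum_i `|(u - v) 0 i|.
  rewrite -[leRHS]mulr1; apply: E => y yv i; apply: vr => j.
  by apply: le_lt_trans (yv j) _; have := uv j; rewrite lt_min => /andP[].
rewrite -(subrK (\sum_i (u - v) 0 i * df i v) (f u - f v)).
apply: le_lt_trans (ler_normD _ _) _.
have S : `|\sum_i (u - v) 0 i * df i v| <= \sum_i `|(u - v) 0 i| * `|df i v|.
  by apply: le_trans (ler_norm_sum _ _ _) _; under eq_bigr do rewrite normrM.
apply: le_lt_trans (lerD E S) _; rewrite -big_split /=.
apply: (@le_lt_trans _ _ (D * (e / (D + 1)))).
  rewrite mulr_suml; apply: ler_sum => i _.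
  rewrite -[X in X + _]mulr1 -mulrDr mulrC (addrC 1) ler_wpM2l ?addr_ge0//.
  by have := uv i; rewrite lt_min => /andP[_ /ltW].
by rewrite mulrCA gtr_pMr// ltr_pdivrMr ?ltr_wpDl// mul1r ltrDl.
Unshelve. all: by end_near. Qed.

End ContinuousPartials.

Arguments partials_continuous {R n f df} _ _.

(** * The Poincare lemma *)

Section Poincare.
Context {R : realType}.

Lemma continuous_sum_fun (T : topologicalType) (I : Type) (r : seq I)
    (F : I -> T -> R) : (forall i, continuous (F i)) ->
  continuous (fun x => \sum_(i <- r) F i x).
Proof.
move=> cF; elim: r => [|i r IH].
  rewrite (_ : (fun x => _) = cst 0); first exact: cst_continuous.
  by apply/funext => x; rewrite big_nil.
rewrite (_ : (fun x => _) = (fun x => F i x + \sum_(i <- r) F i x)).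
  by move=> x; exact: (cvgD (cF i x) (IH x)).
by apply/funext => x; rewrite big_cons.
Qed.

Lemma continuous_mul_fun (T : topologicalType) (f g : T -> R) :
  continuous f -> continuous g -> continuous (fun x => f x * g x).
Proof. by move=> cf cg x; exact: (cvgM (cf x) (cg x)). Qed.

Variables (n : nat) (a : 'I_n -> 'rV[R]_n -> R).
Hypothesis sa : forall i, smoothf (a i).
Hypothesis closed_a : forall i j v, partial i (a j) v = partial j (a i) v.

(** The form evaluated on the velocity of the segment from 0 to [v]; its integral is the usual
    homotopy operator of a star-shaped domain. *)
Definition cone_integrand (v : 'rV[R]_n) (s : R) : R :=
  \sum_i a i (s *: v) * v 0 i.

Definition cone_potential (v : 'rV[R]_n) : R :=
  \int[lebesgue_measure]_(s in `[0, 1]) cone_integrand v s.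

(** The derivative in [h] of the cone integrand at [h *: delta_mx 0 j + v]. The variable [h] is kept
    because differentiation under the integral sign requires a bound for all [h] near 0. *)
Definition cone_integrand' (v : 'rV[R]_n) (j : 'I_n) (h s : R) : R :=
  \sum_i (s * partial j (a i) (s *: (h *: delta_mx 0 j + v)) *
             (h *: delta_mx 0 j + v) 0 i +
          a i (s *: (h *: delta_mx 0 j + v)) * (j == i)%:R).

Lemma is_derive_smooth i v w :
  is_derive v w (a i) (\sum_k w 0 k * partial k (a i) v).
Proof.
apply: (@is_derive_partials R n (a i) (fun k => partial k (a i))) => [k u|k].
  exact: (Ck_on_is_derive (@sa i 1%N)).
exact: (Ck_on_continuous (smooth_partial k (sa i) 0%N)).
Qed.

Lemma delta_mxE (k j : 'I_n) : (delta_mx 0 k : 'rV[R]_n) 0 j = (k == j)%:R.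
Proof. by rewrite mxE eqxx eq_sym. Qed.

Lemma cone_integrand_derive v j (s h : R) :
  is_derive h (1 : R) (fun r : R => cone_integrand (r *: delta_mx 0 j + v) s)
    (cone_integrand' v j h s).
Proof.
have E : (fun r : R => cone_integrand (r *: delta_mx 0 j + v) s) =
    \sum_i ((fun r => a i (r *: (s *: delta_mx 0 j) + s *: v)) *
            (fun r => (r *: delta_mx 0 j + v) 0 i) : R -> R).
  apply/funext => r; rewrite fct_sumE; apply: eq_bigr => i _ /=.
  rewrite [RHS]/GRing.mul /=; congr (a i _ * _).
  by rewrite scalerDr !scalerA (mulrC s).
rewrite E; apply: is_derive_sum => i.
have d1 := (is_derive_line (a i) (s *: v) (s *: delta_mx 0 j) h _).1
  (is_derive_smooth i _ _).
have d2 := (is_derive_line (fun u : 'rV[R]_n => u 0 i) v (delta_mx 0 j) h _).1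
  (is_derive_coord i _ _).
have := is_deriveM d1 d2.
rewrite delta_mxE (bigD1 j)//= big1 ?addr0; last first.
  by move=> k kj; rewrite mxE delta_mxE eq_sym (negbTE kj) mulr0 mul0r.
have -> : (s *: delta_mx 0 j : 'rV[R]_n) 0 j = s.
  by rewrite mxE delta_mxE eqxx mulr1.
rewrite (_ : h *: (s *: delta_mx 0 j) + s *: v = s *: (h *: delta_mx 0 j + v)); last first.
  by rewrite scalerDr !scalerA (mulrC s).
move=> H; apply: is_derive_eq H _.
by rewrite addrC; congr (_ + _); rewrite [LHS]mulrC.
Qed.

Lemma continuous_cone_arg (v e : 'rV[R]_n) :
  continuous (fun p : R * R => p.2 *: (p.1 *: e + v)).
Proof.
move=> p; apply: cvgZ; first exact: cvg_snd.
apply: cvgD; last exact: cvg_cst.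
by apply: cvgZ; [exact: cvg_fst|exact: cvg_cst].
Qed.

Lemma continuous_cone_integrand' v j :
  continuous (fun p : R * R => cone_integrand' v j p.1 p.2).
Proof.
have ca := @continuous_cone_arg v (delta_mx 0 j).
apply: continuous_sum_fun => i p; apply: cvgD; last first.
  apply: cvgM; last exact: cvg_cst.
  exact: continuous_comp (ca p) (Ck_on_continuous (sa i 0%N) _).
apply: cvgM; first apply: cvgM; first exact: cvg_snd.
  exact: continuous_comp (ca p)
    (Ck_on_continuous (smooth_partial j (sa i) 0%N) _).
have E : (fun p : R * R => (p.1 *: delta_mx 0 j + v) 0 i) =
  (fun p : R * R => p.1 * (delta_mx 0 j : 'rV[R]_n) 0 i + v 0 i).
  by apply/funext => q; rewrite !mxE.
rewrite E !mxE; apply: cvgD; last exact: cvg_cst.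
by apply: cvgM; [exact: cvg_fst|exact: cvg_cst].
Qed.


Lemma continuous_cone_integrand v : continuous (cone_integrand v).
Proof.
apply: continuous_sum_fun => i; apply: continuous_mul_fun => [s|]; last first.
  exact: cst_continuous.
apply: (@continuous_comp _ _ _ (fun s : R => s *: v) (a i)).
  exact: scalel_continuous.
exact: (Ck_on_continuous (sa i 0%N)).
Qed.

Lemma integrable_itv01 (f : R -> R) : continuous f ->
  lebesgue_measure.-integrable `[0, 1] (EFin \o f).
Proof.
move=> cf; apply: continuous_compact_integrable; first exact: segment_compact.
exact: continuous_subspaceT.
Qed.

(** Compactness of the rectangle supplies a constant dominating function. *)
Lemma cone_integrand'_bounded v j : exists C, forall h s : R,
  -1 <= h <= 1 -> 0 <= s <= 1 -> `|cone_integrand' v j h s| <= C.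
Proof.
have K : compact (`[-1, 1]%classic `*` `[0, 1]%classic : set (R * R)).
  by apply: compact_setX; exact: segment_compact.
have cK : compact ((fun p : R * R => cone_integrand' v j p.1 p.2) @`
    (`[-1, 1]%classic `*` `[0, 1]%classic)).
  apply: continuous_compact K; apply: continuous_subspaceT.
  exact: continuous_cone_integrand'.
have [M [_ MB]] := compact_bounded cK.
exists (M + 1) => h s h1 s1; apply: (MB (M + 1)); first by rewrite ltrDl.
by exists (h, s) => //; split; rewrite /= in_itv.
Qed.

(** Closedness exchanges the indices of the partial derivatives, after which the integrand is the
    derivative of [s * a j (s *: v)] and the fundamental theorem of calculus applies. *)
Lemma cone_integral v j :
  \int[lebesgue_measure]_(s in `[0, 1]) cone_integrand' v j 0 s = a j v.
Proof.
have E : cone_integrand' v j 0 =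
    fun s => s * (\sum_i v 0 i * partial i (a j) (s *: v)) + a j (s *: v).
  apply/funext => s; rewrite /cone_integrand' scale0r add0r big_split /=.
  congr (_ + _).
    rewrite mulr_sumr; apply: eq_bigr => i _.
    by rewrite closed_a -mulrA; congr (_ * _); rewrite mulrC.
  rewrite (bigD1 j)//= eqxx mulr1 big1 ?addr0// => i ij.
  by rewrite eq_sym (negbTE ij) mulr0.
have d (s : R) : is_derive s (1 : R) (fun s => s * a j (s *: v) : R)
    (cone_integrand' v j 0 s).
  have d1 : is_derive s (1 : R) (fun s : R => a j (s *: v))
      (\sum_i v 0 i * partial i (a j) (s *: v)).
    have := (is_derive_line (a j) 0 v s _).1 (is_derive_smooth j _ _).
    rewrite addr0 (_ : (fun r : R => a j (r *: v + 0)) = fun s : R => a j (s *: v)) //.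
    by apply/funext => r; rewrite addr0.
  have := is_deriveM (is_derive_id s (1 : R)) d1.
  by rewrite E => H; apply: is_derive_eq H _; congr (_ + _); rewrite [LHS]mulr1.
have cK (s : R) : {for s, continuous (fun s : R => s * a j (s *: v) : R)}.
  by apply/differentiable_continuous/derivable1_diffP.
have c' : continuous (cone_integrand' v j 0).
  move=> s; apply: (@continuous_comp _ _ _ (fun s : R => (0 : R, s))
    (fun p => cone_integrand' v j p.1 p.2)); last exact: continuous_cone_integrand'.
  have H := @cvg_pair _ _ _ (nbhs s) (nbhs (0 : R)) (nbhs s) _ _ _ (cst 0) id.
  by apply: H; [exact: cvg_cst|exact: cvg_id].
rewrite /Rintegral (@continuous_FTC2 R _ (fun s => s * a j (s *: v)) 0 1)//.
- by rewrite mul0r mul1r scale1r sube0.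
- exact: continuous_subspaceT.
- split.
  + by move=> s _; exact: ex_derive.
  + exact: cvg_at_right_filter (cK 0).
  + exact: cvg_at_left_filter (cK 1).
- by move=> s _; rewrite derive1E derive_val.
Qed.

Lemma cone_potential_derive v j :
  is_derive v (delta_mx 0 j) cone_potential (a j v).
Proof.
refine (proj2 (@is_derive_along _ _ R _ _ _ _) _).
have [C CB] := cone_integrand'_bounded v j.
pose f (h s : R) := cone_integrand (h *: delta_mx 0 j + v) s.
have f' h s : partial1of2 f h s = cone_integrand' v j h s.
  have := cone_integrand_derive v j s h.
  by rewrite partial1of2E => H; rewrite derive_val.
have C0 : 0 <= C.
  have := CB 0 0; rewrite lexx lerN10 ler01 => /(_ isT isT); exact: le_trans.
have mI : measurable (`[0, 1]%classic : set (measurableTypeR R)) by [].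
have I0 : (`](-1 : R), 1[%classic : set R) 0 by rewrite /= in_itv /= ltrN10 ltr01.
have If h : `](-1 : R), 1[%classic h ->
    lebesgue_measure.-integrable `[0, 1] (EFin \o f h).
  by move=> _; apply: integrable_itv01; exact: continuous_cone_integrand.
have df (h s : R) : `](-1 : R), 1[%classic h -> `[0, 1]%classic s ->
    derivable (f^~ s) h 1.
  by move=> _ _; have [] := cone_integrand_derive v j s h.
have IC : (@lebesgue_measure R).-integrable `[0, 1] (EFin \o cst C).
  by apply: integrable_itv01; exact: cst_continuous.
have fC (h s : R) : `](-1 : R), 1[%classic h -> `[0, 1]%classic s ->
    `|partial1of2 f h s| <= cst C s.
  rewrite /= !in_itv /= => /andP[h1 h2] s01; rewrite f'; apply: CB => //.
  by rewrite !ltW.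
have D := differentiation_under_integral mI I0 If df (fun=> C0) IC fC.
have D' := derivable_under_integral mI I0 If df (fun=> C0) IC fC.
apply: (DeriveDef D'); rewrite -derive1E D -[RHS](cone_integral v).
by apply: eq_Rintegral => s _; exact: f'.
Qed.

End Poincare.

(** * The group *)

Section Coordinates.
Context {R : realType}.

Definition i0 : 'I_3 := @Ordinal 3 0 isT.
Definition i1 : 'I_3 := @Ordinal 3 1 isT.
Definition i2 : 'I_3 := @Ordinal 3 2 isT.

Lemma ord3P (P : 'I_3 -> Prop) : P i0 -> P i1 -> P i2 -> forall i, P i.
Proof.
move=> P0 P1 P2 [[|[|[|//]]] lti].
- by rewrite (_ : Ordinal lti = i0)//; exact: val_inj.
- by rewrite (_ : Ordinal lti = i1)//; exact: val_inj.
- by rewrite (_ : Ordinal lti = i2)//; exact: val_inj.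
Qed.

Definition vec3 (t x y : R) : 'rV[R]_3 := \row_(j < 3) [:: t; x; y]`_j.

Lemma vec3_0 t x y : vec3 t x y 0 i0 = t. Proof. by rewrite mxE. Qed.
Lemma vec3_1 t x y : vec3 t x y 0 i1 = x. Proof. by rewrite mxE. Qed.
Lemma vec3_2 t x y : vec3 t x y 0 i2 = y. Proof. by rewrite mxE. Qed.
Definition vec3E := (vec3_0, vec3_1, vec3_2).

Lemma row3P (u v : 'rV[R]_3) :
  u 0 i0 = v 0 i0 -> u 0 i1 = v 0 i1 -> u 0 i2 = v 0 i2 -> u = v.
Proof. by move=> *; apply/rowP; apply: ord3P. Qed.

Lemma smooth_vec3 n (f g h : 'rV[R]_n -> R) :
  smoothf f -> smoothf g -> smoothf h ->
  forall j, smoothf (fun v => vec3 (f v) (g v) (h v) 0 j).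
Proof.
move=> sf sg sh; apply: ord3P.
- by rewrite (_ : (fun v => _) = f)//; apply/funext => v; rewrite vec3E.
- by rewrite (_ : (fun v => _) = g)//; apply/funext => v; rewrite vec3E.
- by rewrite (_ : (fun v => _) = h)//; apply/funext => v; rewrite vec3E.
Qed.

End Coordinates.

(** * A countable base of rational boxes *)

Section RationalBoxes.
Context {R : realType}.

Definition rat_box n (l r : 'rV[rat]_n) : set 'rV[R]_n :=
  [set v | forall j, ratr (l 0 j) < v 0 j < ratr (r 0 j)].

Lemma open_rat_box n (l r : 'rV[rat]_n) : open (rat_box l r).
Proof.
rewrite openE => v vlr.
exists (fun _ j => [set x | ratr (l 0 j) < x < ratr (r 0 j)]).
  move=> i j; rewrite ord1.
  have := near_in_itvoo (vlr j : v 0 j \in `](ratr (l 0 j)), (ratr (r 0 j))[).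
  by apply: filterS => x; rewrite in_itv.
by move=> w wlr j; exact: wlr.
Qed.

Lemma open_rat_boxP n (U : set 'rV[R]_n) x : open U -> U x ->
  exists l r, rat_box l r x /\ rat_box l r `<=` U.
Proof.
rewrite openE => /[apply] -[P xP PU].
have /choice[lr lrP] j : exists lr : rat * rat,
    ratr lr.1 < x 0 j < ratr lr.2 /\
    [set y | ratr lr.1 < y < ratr lr.2] `<=` P 0 j.
  have /nbhs_ballP[e /= e0 xe] := xP 0 j.
  have /rat_in_itvoo[l] : x 0 j - e < x 0 j by rewrite ltrBlDr ltrDl.
  have /rat_in_itvoo[r] : x 0 j < x 0 j + e by rewrite ltrDl.
  rewrite !in_itv/= => /andP[xr re] /andP[xl lx]; exists (l, r) => /=.
  split=> [|y /= /andP[ly yr]]; first by rewrite lx xr.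
  apply: xe; rewrite /ball/= ltr_distlC; apply/andP; split.
    exact: lt_trans ly.
  exact: lt_trans re.
exists (\row_j (lr j).1), (\row_j (lr j).2); split=> [j|v vlr].
  by rewrite !mxE; have [] := lrP j.
apply: PU => i j; rewrite ord1; have [_] := lrP j; apply => /=.
by have := vlr j; rewrite !mxE.
Qed.

End RationalBoxes.

(** * The product formula on R^3 *)

Section ScrewProduct.
Context {R : realType}.

(* With z = x + iy, the point (t, z) displaced by (a s, exp(i pi p t) z'), where
   (s, z') is the second argument; a = p = 1 is the group law, and a = 1/3,
   p = 3 is the competing action. *)
Definition screw_mul (a p : R) (u v : 'rV[R]_3) : 'rV[R]_3 :=
  let c := cos (pi * (p * u 0 i0)) in let s := sin (pi * (p * u 0 i0)) in
  vec3 (u 0 i0 + a * v 0 i0)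
       (u 0 i1 + (c * v 0 i1 - s * v 0 i2))
       (u 0 i2 + (s * v 0 i1 + c * v 0 i2)).

Definition screw_inv (u : 'rV[R]_3) : 'rV[R]_3 :=
  let c := cos (pi * u 0 i0) in let s := sin (pi * u 0 i0) in
  vec3 (- u 0 i0) (- (c * u 0 i1 + s * u 0 i2)) (s * u 0 i1 - c * u 0 i2).

(** The angle at the displaced point is p (t + a t') = p t + t', which is where [a * p = 1] enters.
    The case a = p = 1 is associativity of the group, the case a = 1/3, p = 3 the action law of the
    competing action. *)
Lemma screw_mulA a p u v w : a * p = 1 ->
  screw_mul a p (screw_mul a p u v) w = screw_mul a p u (screw_mul 1 1 v w).
Proof.
move=> ap1; rewrite /screw_mul !vec3E.
have -> : pi * (p * (u 0 i0 + a * v 0 i0)) =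
    pi * (p * u 0 i0) + pi * v 0 i0 :> R.
  by rewrite !mulrDr; congr (_ + _); rewrite (mulrA p) (mulrC p) ap1 mul1r.
by apply: row3P; rewrite !vec3E ?cosD ?sinD mul1r; ring.
Qed.

Lemma screw_mul1 a p u : screw_mul a p u 0 = u.
Proof. by apply: row3P; rewrite !vec3E !mxE; ring. Qed.

Lemma screw_1mul u : screw_mul 1 1 0 u = u.
Proof.
by apply: row3P; rewrite !vec3E !mxE ?mulr0 ?cos0 ?sin0; ring.
Qed.

Lemma screw_mulV u : screw_mul 1 1 (screw_inv u) u = 0.
Proof.
have cs := cos2Dsin2 (pi * u 0 i0).
apply: row3P; rewrite /screw_mul !vec3E ?mul1r ?mulrN ?cosN ?sinN !mxE; ring.
Qed.

Lemma screw_mul_inv u : screw_mul 1 1 u (screw_inv u) = 0.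
Proof.
have cs := cos2Dsin2 (pi * u 0 i0).
apply: row3P; rewrite /screw_mul !vec3E ?mul1r !mxE ?subrr//.
- transitivity (u 0 i1 * (1 - (cos (pi * u 0 i0) ^+ 2 + sin (pi * u 0 i0) ^+ 2))).
    by ring.
  by rewrite cs subrr mulr0.
- transitivity (u 0 i2 * (1 - (cos (pi * u 0 i0) ^+ 2 + sin (pi * u 0 i0) ^+ 2))).
    by ring.
  by rewrite cs subrr mulr0.
Qed.

Lemma smooth_screw_mul n a p (f g : 'rV[R]_n -> 'rV[R]_3) :
  (forall j, smoothf (fun v => f v 0 j)) ->
  (forall j, smoothf (fun v => g v 0 j)) ->
  forall j, smoothf (fun v => screw_mul a p (f v) (g v) 0 j).
Proof.
move=> sf sg; have sa : smoothf (fun v => pi * (p * f v 0 i0)).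
  by do 2 (apply: smoothM; first exact: smooth_cst).
apply: smooth_vec3.
- by apply: smoothD => //; apply: smoothM => //; exact: smooth_cst.
- apply: smoothD => //; apply: smoothD.
    by apply: smoothM => //; exact: smooth_cos.
  by apply: smoothN; apply: smoothM => //; exact: smooth_sin.
- apply: smoothD => //; apply: smoothD.
    by apply: smoothM => //; exact: smooth_sin.
  by apply: smoothM => //; exact: smooth_cos.
Qed.

Lemma smooth_screw_inv j : smoothf (fun v => screw_inv v 0 j).
Proof.
have sc := @smooth_coord R 3.
have sa : smoothf (fun v : 'rV[R]_3 => pi * v 0 i0).
  by apply: smoothM => //; exact: smooth_cst.
move: j; apply: smooth_vec3.
- exact: smoothN.
- apply: smoothN; apply: smoothD; apply: smoothM => //.
    exact: smooth_cos.
  exact: smooth_sin.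
- apply: smoothD; last apply: smoothN; apply: smoothM => //.
    exact: smooth_sin.
  exact: smooth_cos.
Qed.

(** Smoothness is stated for functions of one row vector, so the pair is first glued into a vector
    of length 6. *)
Lemma continuous_screw_mul a p :
  continuous (fun w : 'rV[R]_3 * 'rV[R]_3 => screw_mul a p w.1 w.2).
Proof.
move=> w.
have s : continuous (fun v : 'rV[R]_(3 + 3) =>
    screw_mul a p (lsubmx v) (rsubmx v)).
  apply: smooth_continuous; apply: smooth_screw_mul => j.
    exact: smooth_lsubmx.
  exact: smooth_rsubmx.
have r : continuous (fun w : 'rV[R]_3 * 'rV[R]_3 => row_mx w.1 w.2).
  have rj j : continuous (fun w : 'rV[R]_3 * 'rV[R]_3 => row_mx w.1 w.2 0 j).
    rewrite -(splitK j); case: (fintype.split j) => k /= z.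
      have -> : (fun w : 'rV[R]_3 * 'rV[R]_3 =>
          row_mx w.1 w.2 0 (lshift 3 k)) = (fun u : 'rV[R]_3 => u 0 k) \o fst.
        by apply/funext => x; rewrite row_mxEl.
      exact: (continuous_comp (@cvg_fst _ _ _ _ _) (@coord_continuous R _ _ 0 k _)).
    have -> : (fun w : 'rV[R]_3 * 'rV[R]_3 =>
        row_mx w.1 w.2 0 (rshift 3 k)) = (fun u : 'rV[R]_3 => u 0 k) \o snd.
      by apply/funext => x; rewrite row_mxEr.
    exact: (continuous_comp (@cvg_snd _ _ _ _ _) (@coord_continuous R _ _ 0 k _)).
  by move=> z; apply: (@cvg_rV _ _ (nbhs z)) => j; exact: rj.
rewrite (_ : (fun w => _) = (fun v : 'rV[R]_(3 + 3) =>
    screw_mul a p (lsubmx v) (rsubmx v)) \o (fun w => row_mx w.1 w.2)).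
  exact: continuous_comp (r w) (s _).
by apply/funext => v /=; rewrite row_mxKl row_mxKr.
Qed.

End ScrewProduct.

(** A separate name for the space, to carry the nonabelian group structure beside the additive one
    of row vectors; both have unit 0. *)
Definition screw (R : realType) : Type := 'rV[R]_3.

Section ScrewGroup.
Context {R : realType}.

HB.instance Definition _ := Topological.on (screw R).

Lemma screw_mulgA : associative (@screw_mul R 1 1 : screw R -> screw R -> screw R).
Proof. by move=> u v w; rewrite screw_mulA// mul1r. Qed.

HB.instance Definition _ := isGroup.Build (screw R)
  screw_mulgA (@screw_1mul R) (@screw_mul1 R 1 1) (@screw_mulV R) screw_mul_inv.
HB.instance Definition _ := GroupSpace.on (screw R).

Lemma screw_mulgE (x y : screw R) : (x * y)%g = screw_mul 1 1 x y.
Proof. by []. Qed.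

Lemma screw_invgE (x : screw R) : (x^-1)%g = screw_inv x.
Proof. by []. Qed.

Definition id_chart : chart R (screw R) 3 := Chart setT idfun idfun.

Lemma id_chart_img : chart_img id_chart = setT.
Proof. by apply/seteqP; split=> // v _; exists v. Qed.

Lemma screw_hausdorff : hausdorff_space (screw R).
Proof. exact: (@norm_hausdorff R 'rV[R]_3). Qed.

Lemma screw_second_countable : @second_countable (screw R).
Proof.
exists [set rat_box lr.1 lr.2 | lr in [set: 'rV[rat]_3 * 'rV[rat]_3]].
  exact: card_le_trans (card_image_le _ _) (countableP _).
split=> [_ [lr _ <-]|x A]; first exact: open_rat_box.
rewrite nbhsE => -[U [oU Ux] UA].
have [l [r [xlr lrU]]] := open_rat_boxP oU Ux.
exists (rat_box l r); last exact: subset_trans UA.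
by split=> //; exists (l, r).
Qed.

Lemma screw_smooth_manifold : is_smooth_manifold [set id_chart].
Proof.
split.
- exact: screw_hausdorff.
- exact: screw_second_countable.
- move=> _ ->; split; rewrite ?id_chart_img//.
  + exact: openT.
  + exact: openT.
  + move=> x _; exact: (@cvg_id _ (nbhs x)).
  + move=> x _; exact: (@cvg_id _ (nbhs x)).
- by move=> x; exists id_chart.
- move=> _ _ -> -> j k; apply: Ck_onS (@smooth_coord R 3 j k) => //.
Qed.

Lemma screw_smooth_inv :
  smooth_map [set id_chart] [set id_chart] (fun x : screw R => (x^-1)%g).
Proof.
split; first exact: (smooth_continuous (@smooth_screw_inv R)).
by move=> _ _ -> -> j k; apply: Ck_onS (@smooth_screw_inv R j k).
Qed.

Lemma screw_smooth_mul : smooth_map (prod_atlas [set id_chart] [set id_chart])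
  [set id_chart] (fun p : screw R * screw R => (p.1 * p.2)%g).
Proof.
split; first exact: (@continuous_screw_mul R 1 1).
move=> _ _ [_ [_ [-> -> ->]]] -> j k; apply: (@Ck_onS _ _ _ setT) => //.
move: j k; apply: smooth_screw_mul => j.
  exact: smooth_lsubmx.
exact: smooth_rsubmx.
Qed.

Definition screw_lie : lieGroup R := LieGroup screw_smooth_manifold
  screw_smooth_mul screw_smooth_inv.

End ScrewGroup.

(** * Connectedness, simple connectedness and solvability *)

Section ScrewTopology.
Context {R : realType}.

Lemma normed_connected (V : normedModType R) : connected [set: V].
Proof.
have cl (v : V) : continuous (fun t : R => t *: v).
  by move=> t; exact: scalel_continuous.
rewrite (_ : setT = \bigcup_(v in [set: V]) range (fun t : R => t *: v)).
  apply: bigcup_connected; first by exists 0 => v _; exists 0; rewrite ?scale0r.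
  move=> v _; apply: connected_continuous_connected.
    exact/connected_intervalP.
  exact/continuous_subspaceT.
by apply/seteqP; split=> // v _; exists v => //; exists 1; rewrite ?scale1r.
Qed.

Lemma screw_connected : connected [set: screw_lie (R:=R)].
Proof. exact: (@normed_connected 'rV[R]_3). Qed.

Lemma normed_simply_connected (V : normedModType R) : simply_connected R V.
Proof.
move=> g cg g01; exists (fun st => g st.2 + st.1 *: (g 0 - g st.2)); split=> /=.
- apply/subspace_continuousP => -[a t] [/= a01 t01].
  set F := within _ _.
  have gt : g st.2 @[st --> F] --> g t.
    have gt1 := (@subspace_continuousP R `[0, 1] V g).1 cg t t01.
    apply: cvg_comp gt1 => B tB.
    have : \forall st \near nbhs (a, t), `[0, 1]%classic st.2 -> B st.2.
      exact: (@cvg_snd R R (nbhs a) (nbhs t) _ _ tB).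
    by rewrite /F /within; apply: filterS => st BS [] _ /BS.
  have sa : st.1 @[st --> F] --> a.
    apply: cvg_within_filter; exact: cvg_fst.
  by apply: cvgD => //; apply: cvgZ => //; apply: cvgB => //; exact: cvg_cst.
- by move=> t _; rewrite scale0r addr0.
- by move=> t _; rewrite scale1r addrC subrK.
- by move=> s _; rewrite -g01 subrr scaler0 addr0.
Qed.

Lemma screw_simply_connected : simply_connected R (screw_lie (R:=R)).
Proof. exact: (@normed_simply_connected 'rV[R]_3). Qed.

Local Open Scope group_scope.

Lemma trivial_subgroup_subproof (G : groupType) :
  [/\ [set (1 : G)] 1, forall x y, [set (1 : G)] x -> [set (1 : G)] y ->
   [set (1 : G)] (x * y) & forall x, [set (1 : G)] x -> [set (1 : G)] x^-1].
Proof. by split=> // [x y -> ->|x ->] /=; rewrite ?mulg1 ?invg1. Qed.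

(** The time coordinate is a homomorphism to the real line, so commutators have time 0; the elements
    of time 0 commute with one another. *)
Lemma screw_solvable : solvable_group (screw_lie (R:=R)).
Proof.
have [tpart tE] : exists H : subgroup (screw R),
    subgroup_set H = [set u : screw R | (u : 'rV[R]_3) 0%R i0 = 0%R].
  unshelve eexists (@Subgroup _ [set u : screw R | (u : 'rV[R]_3) 0%R i0 = 0%R] _ _ _) => //.
  - by rewrite /= [LHS]mxE.
  - by move=> x y /= x0 y0; rewrite screw_mulgE vec3E x0 y0 mulr0 addr0.
  - by move=> x /= x0; rewrite screw_invgE vec3E x0 oppr0.
have D1 (x : screw R) : derived_subgroup 1 x -> (x : 'rV[R]_3) 0%R i0 = 0%R.
  move=> /(_ tpart); rewrite tE; apply=> _ [a [b [_ _ ->]]] /=.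
  rewrite /commg /conjg !screw_mulgE !screw_invgE !vec3E; ring.
exists 2%N; apply/seteqP; split=> [x|_ ->]; last by move=> H _; exact: subgroup1.
have [t1 tM tV] := trivial_subgroup_subproof (screw R).
move=> /(_ (Subgroup t1 tM tV)); apply=> _ [a [b [/D1 a0 /D1 b0 ->]]] /=.
apply/eqP/commgP; apply: row3P;
  rewrite /commute !screw_mulgE !vec3E a0 b0 ?mulr0 ?cos0 ?sin0; ring.
Qed.
End ScrewTopology.

(** * The lattice of integer points *)

Section CosetGeneral.
Local Open Scope group_scope.

Lemma coset_projP (G : groupSpaceType) (Gamma : subgroup G) (x y : G) :
  coset_proj Gamma x = coset_proj Gamma y <->
  exists2 g, subgroup_set Gamma g & x = g * y.
Proof.
split=> [/eqmodP/asboolP xy|[g Gg ->]].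
  by exists (x * y^-1) => //; rewrite mulgVK.
by apply/eqmodP/asboolP; rewrite mulgK.
Qed.

Lemma coset_proj_mul (G : groupSpaceType) (Gamma : subgroup G) (g x : G) :
  subgroup_set Gamma g -> coset_proj Gamma (g * x) = coset_proj Gamma x.
Proof. by move=> Gg; apply/coset_projP; exists g. Qed.

Lemma coset_proj_repr (G : groupSpaceType) (Gamma : subgroup G)
  (m : coset_space Gamma) : coset_proj Gamma (repr m) = m.
Proof. exact: reprK. Qed.

Lemma coset_proj_continuous (G : groupSpaceType) (Gamma : subgroup G) :
  continuous (coset_proj Gamma).
Proof. exact: pi_continuous. Qed.

(** The saturation of an open set is a union of its translates by elements of the subgroup. *)
Lemma open_coset_proj (G : groupSpaceType) (Gamma : subgroup G) (A : set G) :
  (forall g : G, continuous (fun x => g * x)) ->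
  open A -> open (coset_proj Gamma @` A).
Proof.
move=> cG oA; rewrite /open /= /quotient_open.
rewrite (_ : _ @^-1` _ =
  \bigcup_(g in subgroup_set Gamma) (fun x => g * x) @^-1` A).
  by apply: bigcup_open => g _; apply: open_comp => // x _; exact: cG.
apply/seteqP; split=> [x [y Ay /esym/coset_projP[g Gg ->]]|x [g Gg Ax]] /=.
  by exists g^-1; [exact: subgroupV|rewrite /= mulKg].
by exists (g * x) => //; exact: coset_proj_mul.
Qed.

End CosetGeneral.

(** * Integer points and local inverses of the projection *)

Section IntegerPoints.
Context {R : realType}.

Lemma sin_int (x : R) : x \is a Num.int -> sin (pi * x) = 0.
Proof.
suff H (n : nat) : sin (pi * n%:R) = 0 :> R.
  by move=> /intrP[[n|n] ->]; rewrite ?NegzE ?mulrNz ?mulrN ?sinN H ?oppr0.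
by elim: n => [|n IH]; rewrite ?mulr0 ?sin0// -natr1 mulrDr mulr1 sinDpi IH oppr0.
Qed.

Lemma cos_int (x : R) : x \is a Num.int ->
  cos (pi * x) = 1 \/ cos (pi * x) = -1.
Proof.
move=> /sin_int s0; have := cos2Dsin2 (pi * x).
rewrite s0 expr0n addr0 => /eqP; rewrite sqrf_eq1 => /orP[]/eqP; by [left|right].
Qed.

Lemma cos_is_int (x : R) : x \is a Num.int -> cos (pi * x) \is a Num.int.
Proof. by move=> /cos_int[] ->; rewrite ?rpredN ?rpred1. Qed.

Lemma int_eq0 (x : R) : x \is a Num.int -> `|x| < 1 -> x = 0.
Proof.
move=> /intrP[m ->]; rewrite -intr_norm ltrz1 => m1.
by apply/eqP; rewrite intr_eq0 -normr_le0 -ltzD1 add0r.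
Qed.

(** After subtraction of the floor the argument lies in [0, pi[, and the sine is positive on ]0,
    pi[. *)
Lemma sin_eq0_int (x : R) : sin (pi * x) = 0 -> x \is a Num.int.
Proof.
move=> s0; pose k : R := (Num.floor x)%:~R.
have ki : k \is a Num.int by exact: intr_int.
have /andP[kx xk] : k <= x < k + 1 by rewrite floor_le -[X in _ + X]mulr1z -intrD floorD1_gt.
move: (s0); rewrite -{1}[x](subrK k) mulrDr sinD (sin_int ki) mulr0 addr0 => /eqP.
rewrite mulf_eq0 => /orP[/eqP|]; last first.
  by have [->|->] := cos_int ki; rewrite ?oppr_eq0 oner_eq0.
have [kx0|xk0] := eqVneq k x; first by rewrite -kx0.
have : 0 < pi * (x - k) < pi.
  apply/andP; split.
    by rewrite mulr_gt0 ?pi_gt0// subr_gt0 lt_neqAle xk0.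
  by rewrite gtr_pMr ?pi_gt0// ltrBlDl.
by move=> /sin_gt0_pi/[swap] ->; rewrite ltxx.
Qed.

Definition int_points : set (screw R) :=
  [set u : 'rV[R]_3 | forall j, u 0 j \is a Num.int].

Lemma int_points1 : int_points 1%g.
Proof. by move=> j; rewrite mxE rpred0. Qed.

(** At integer time the rotation is 1 or -1, so left translation by a lattice element acts on each
    coordinate separately. *)
Lemma int_points_mulE (g x : screw R) : int_points g -> (g * x)%g =
  vec3 (g 0 i0 + x 0 i0) (g 0 i1 + cos (pi * g 0 i0) * x 0 i1)
       (g 0 i2 + cos (pi * g 0 i0) * x 0 i2).
Proof.
move=> Gg; rewrite screw_mulgE; apply: row3P;
  rewrite /screw_mul !vec3E !mul1r ?sin_int//; ring.
Qed.

Lemma int_pointsM (x y : screw R) :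
  int_points x -> int_points y -> int_points (x * y)%g.
Proof.
move=> Gx Gy; rewrite int_points_mulE//.
by apply: ord3P; rewrite vec3E rpredD ?rpredM ?cos_is_int.
Qed.

Lemma int_pointsV (x : screw R) : int_points x -> int_points (x^-1)%g.
Proof.
move=> Gx; rewrite screw_invgE /screw_inv sin_int//.
by apply: ord3P; rewrite vec3E ?mul0r ?sub0r ?addr0 !rpredN ?rpredM ?cos_is_int.
Qed.

Definition int_lattice : subgroup (screw R) :=
  Subgroup int_points1 int_pointsM int_pointsV.

Local Notation proj := (coset_proj int_lattice).

Lemma proj_small_inj (x y : screw R) : (forall j, `|x 0 j - y 0 j| < 1) ->
  proj x = proj y -> x = y.
Proof.
move=> xy /coset_projP[g Gg]; rewrite int_points_mulE// => xE.
have E0 : g 0 i0 = 0.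
  by apply: int_eq0 => //; have := xy i0; rewrite xE vec3E addrK.
(* Time comes first: only when its shift vanishes is the sign known to be +1, which makes the other
   two differences integers. *)
move: xE; rewrite E0 mulr0 cos0 add0r !mul1r => xE.
have E1 : g 0 i1 = 0.
  by apply: int_eq0 => //; have := xy i1; rewrite xE vec3E addrK.
have E2 : g 0 i2 = 0.
  by apply: int_eq0 => //; have := xy i2; rewrite xE vec3E addrK.
by apply: row3P; rewrite xE vec3E ?E1 ?E2 ?add0r.
Qed.

Lemma ball_coord n (u v : 'rV[R]_n) e j : ball u e v -> `|u 0 j - v 0 j| < e.
Proof. by move=> [_]; exact. Qed.

(** Radius 1/2 keeps the coordinates of any two points of the ball at distance less than 1. *)
Lemma proj_ball_inj (c x y : screw R) :
  ball (c : 'rV[R]_3) (1 / 2) x -> ball (c : 'rV[R]_3) (1 / 2) y ->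
  proj x = proj y -> x = y.
Proof.
move=> cx cy; apply: proj_small_inj => j.
have := ball_coord j cx; have := ball_coord j cy.
have := ler_normB (c 0 j - y 0 j) (c 0 j - x 0 j).
rewrite (_ : c 0 j - y 0 j - (c 0 j - x 0 j) = x 0 j - y 0 j); last by ring.
lra.
Qed.

(** Serves twice: for the discreteness of the lattice and for that of the isotropy groups of the
    competing action. *)
Lemma proj_fiber_discrete (m : coset_space int_lattice) :
  is_discrete (proj @^-1` [set m]).
Proof.
move=> x /= xm; split; first exact/mem_set.
exists (ball (x : 'rV[R]_3) (1 / 2)).
  by apply: (@nbhsx_ballx R 'rV[R]_3 x); lra.
apply/seteqP; split=> [y [xy ym]|_ ->] /=.
  apply: (@proj_ball_inj x) => //; last by rewrite ym xm.
  by apply: (@ballxx R 'rV[R]_3 x); lra.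
by split=> //; apply: (@ballxx R 'rV[R]_3 x); lra.
Qed.

Lemma int_lattice_discrete : is_discrete int_lattice.
Proof.
rewrite (_ : subgroup_set _ = proj @^-1` [set proj 1%g]).
  exact: proj_fiber_discrete.
apply/seteqP; split=> [x Gx|x /coset_projP[g Gg ->]] /=.
  by rewrite -[x]mulg1 coset_proj_mul.
by rewrite mulg1.
Qed.

Lemma continuous_lmul (g : screw R) : continuous (fun x : screw R => (g * x)%g).
Proof.
apply: smooth_continuous; apply: smooth_screw_mul => j.
  exact: smooth_cst.
exact: smooth_coord.
Qed.

Lemma open_proj (A : set (screw R)) : open A -> open (proj @` A).
Proof. by apply: open_coset_proj; exact: continuous_lmul. Qed.

(** The only chart of S is the identity, so a chart of the quotient is simply a local inverse of the
    projection, with values in a sheet [V]. *)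
Lemma coset_atlasP (d : chart R (coset_space int_lattice) 3) :
  coset_atlas (S := screw_lie) int_lattice d -> exists V : set (screw R),
  [/\ open V, forall x y, V x -> V y -> proj x = proj y -> x = y,
      chart_dom d = proj @` V /\ chart_img d = V,
      (forall x, V x -> chart_map d (proj x) = x) &
      (forall x, V x -> chart_inv d x = proj x)].
Proof.
move=> [_ [V [[-> _] oV injV domd dE]]]; exists V; split=> //; first split=> //.
- rewrite /chart_img domd; apply/seteqP; split=> [_ [_ [x Vx <-] <-]|x Vx].
    by have [->] := dE x Vx.
  by exists (proj x); [exists x|have [->] := dE x Vx].
- by move=> x /dE[].
- by move=> x /dE[].
Qed.

(** The sheet of the chart is open and contains a translate of [f v], hence the same translate of
    [f u] for [u] near [v]: a single [g] works in a neighbourhood. *)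
Lemma local_lift (T : topologicalType) (f : T -> screw R) (v : T)
    (d : chart R (coset_space int_lattice) 3) :
  {for v, continuous f} -> coset_atlas (S := screw_lie) int_lattice d ->
  chart_dom d (proj (f v)) ->
  exists2 g : screw R, int_points g &
    \forall u \near v, chart_map d (proj (f u)) = (g * f u)%g.
Proof.
move=> cf /coset_atlasP[V [oV _ [domd _] dV _]].
rewrite domd => -[x Vx /coset_projP[g Gg xE]].
exists g => //; have : \forall u \near v, V (g * f u)%g.
  apply: (@continuous_comp _ _ _ f (fun x => g * x)%g v cf (@continuous_lmul _ _)).
  by apply: open_nbhs_nbhs; split=> //; rewrite /= -xE.
by apply: filterS => u Vu; rewrite -(dV _ Vu) coset_proj_mul.
Qed.

End IntegerPoints.

(** * The competing action *)

Section CompetingAction.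
Context {R : realType}.
Local Notation proj := (coset_proj (@int_lattice R)).
Local Notation M := (coset_space (@int_lattice R)).
Local Notation tmul := (@screw_mul R 3^-1 3).

Lemma screw_mul_inj a p (u : 'rV[R]_3) : a != 0 -> injective (screw_mul a p u).
Proof.
move=> a0 v w; set c := cos (pi * (p * u 0 i0)); set s := sin (pi * (p * u 0 i0)).
have cs : c ^+ 2 + s ^+ 2 = 1 by exact: cos2Dsin2.
move=> vw; have := congr1 (fun z : 'rV[R]_3 => z 0 i0) vw.
have := congr1 (fun z : 'rV[R]_3 => z 0 i1) vw.
have := congr1 (fun z : 'rV[R]_3 => z 0 i2) vw.
rewrite /screw_mul !vec3E -/c -/s => /addrI e2 /addrI e1 /addrI e0.
apply: row3P.
- exact: (mulfI a0 e0).
- rewrite -[LHS]mul1r -[RHS]mul1r -cs.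
  transitivity (c * (c * v 0 i1 - s * v 0 i2) + s * (s * v 0 i1 + c * v 0 i2)).
    by ring.
  by rewrite e1 e2; ring.
- rewrite -[LHS]mul1r -[RHS]mul1r -cs.
  transitivity (c * (s * v 0 i1 + c * v 0 i2) - s * (c * v 0 i1 - s * v 0 i2)).
    by ring.
  by rewrite e1 e2; ring.
Qed.

Lemma screw_mul_surj a p (u w : 'rV[R]_3) : a != 0 ->
  exists v, screw_mul a p u v = w.
Proof.
move=> a0; set c := cos (pi * (p * u 0 i0)); set s := sin (pi * (p * u 0 i0)).
have cs : c ^+ 2 + s ^+ 2 = 1 by exact: cos2Dsin2.
pose d := w - u.
(* The inverse rotation applied to the displacement, with time rescaled by [a]. *)
exists (vec3 (d 0 i0 / a) (c * d 0 i1 + s * d 0 i2) (c * d 0 i2 - s * d 0 i1)).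
apply: row3P; rewrite /screw_mul !vec3E -/c -/s.
- by rewrite mulrCA divff// mulr1 /d !mxE; ring.
- transitivity (u 0 i1 + (c ^+ 2 + s ^+ 2) * d 0 i1); first by ring.
  by rewrite cs mul1r /d !mxE; ring.
- transitivity (u 0 i2 + (c ^+ 2 + s ^+ 2) * d 0 i2); first by ring.
  by rewrite cs mul1r /d !mxE; ring.
Qed.

(* Since 3 is odd, exp(3 i pi k) = exp(i pi k) for every integer k. *)
Lemma tmul_equivariant (g x y : screw R) : int_points g ->
  tmul (g * x)%g y = (g * tmul x y)%g.
Proof.
move=> Gg; rewrite !int_points_mulE// /screw_mul !vec3E.
have s0 := sin_int (Gg i0).
have -> : pi * (3 * (g 0 i0 + x 0 i0)) =
  pi * g 0 i0 + (pi * g 0 i0 + pi * g 0 i0) + pi * (3 * x 0 i0) :> R by ring.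
have c3 : cos (pi * g 0 i0 + (pi * g 0 i0 + pi * g 0 i0)) = cos (pi * g 0 i0).
  rewrite !cosD !sinD s0.
  by have [->|->] := cos_int (Gg i0); ring.
have s3 : sin (pi * g 0 i0 + (pi * g 0 i0 + pi * g 0 i0)) = 0.
  by rewrite !sinD s0; ring.
by rewrite (cosD _ (pi * (3 * _))) (sinD _ (pi * (3 * _))) c3 s3; apply: row3P; rewrite !vec3E; ring.
Qed.

Definition twisted_act (m : M) (s : screw R) : M := proj (tmul (repr m) s).

Lemma twisted_actE (x s : screw R) : twisted_act (proj x) s = proj (tmul x s).
Proof.
have [g Gg xE] := (coset_projP _ _ _).1 (coset_proj_repr (proj x)).
by rewrite /twisted_act xE tmul_equivariant// coset_proj_mul.
Qed.

Lemma invr3_neq0 : 3^-1 != 0 :> R. Proof. by rewrite invr_eq0 pnatr_eq0. Qed.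

Lemma right_action_twisted : right_action (S := screw_lie) twisted_act.
Proof.
split=> [x|x s t]; rewrite -(coset_proj_repr x) !twisted_actE.
  by rewrite screw_mul1.
by rewrite screw_mulA// mulVf// pnatr_eq0.
Qed.

(** The product of the projection with the identity of S is not known in advance to be a quotient
    map, so neighbourhoods are pushed down by hand, using that the projection is open. *)
Lemma continuous_twisted :
  continuous (fun p : M * screw R => twisted_act p.1 p.2).
Proof.
move=> [m s] A /=; rewrite -(coset_proj_repr m) twisted_actE => mA.
have : nbhs (repr m : screw R, s) ((fun w => tmul w.1 w.2) @^-1` (proj @^-1` A)).
  apply: (@continuous_screw_mul R 3^-1 3 (repr m : 'rV[R]_3, s)).
  exact: (@coset_proj_continuous _ _ _ _ mA).
move=> [[P Q] /= [mP sQ] PQ]; exists (proj @` P, Q) => /=; last first.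
  by move=> [_ t] /= [[x Px <-] Qt]; rewrite twisted_actE; exact: (PQ (x, t)).
split=> //; move: mP; rewrite nbhsE => -[U [oU Um] UP].
rewrite nbhsE; exists (proj @` U); last exact: image_subset.
by split; [exact: open_proj|exists (repr m : screw R)].
Qed.

Lemma smooth_twisted : smooth_map
  (prod_atlas (coset_atlas (S := screw_lie) int_lattice) [set id_chart])
  (coset_atlas (S := screw_lie) int_lattice)
  (fun p : M * screw R => twisted_act p.1 p.2).
Proof.
split; first exact: continuous_twisted.
move=> _ d [c [_ [Ac -> ->]]] Ad j k.
have [V [oV _ [domc _] cV cI]] := coset_atlasP Ac.
pose f (v : 'rV[R]_(3 + 3)) : screw R := tmul (lsubmx v) (rsubmx v).
have sf i : smoothf (fun v => f v 0 i) by apply: smooth_screw_mul => l; [exact: smooth_lsubmx|exact: smooth_rsubmx].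
apply: Ck_on_loc => _ [[m s] [[/= dm _] dms] <-].
move: dm dms; rewrite domc => -[x Vx <-]; rewrite (cV _ Vx) twisted_actE => dxs.
set v := row_mx _ _.
have cf : {for v, continuous f} by apply: smooth_continuous.
have fv : f v = tmul x s by rewrite /f /v row_mxKl row_mxKr.
(* In charts the action becomes the product formula followed by a fixed lattice translation. *)
have [|g Gg gE] := local_lift cf Ad; first by rewrite fv.
exists setT, (fun u => (g * f u)%g 0 j); split=> //.
  apply: (@smooth_screw_mul _ _ 1 1 (fun _ => g) f) => // i; exact: smooth_cst.
have : \forall u \near v, V (lsubmx u : screw R).
  apply: (smooth_continuous (@smooth_lsubmx R 3 3)); apply: open_nbhs_nbhs; split=> //.
  by rewrite /v /= row_mxKl.
by apply: filterS2 gE => u gE Vu; rewrite /transport /= cI// twisted_actE gE.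
Qed.

(** The isotropy group of [proj y] is the preimage of a discrete fibre under the continuous
    injective map [tmul y]. *)
Lemma twisted_locally_free x : is_discrete [set s : screw R | twisted_act x s = x].
Proof.
rewrite -(coset_proj_repr x); set y : screw R := repr x.
move=> s /= ys; split; first exact/mem_set.
rewrite twisted_actE in ys.
have [_ [W W1 W2]] := proj_fiber_discrete ys.
exists (tmul y @^-1` W).
  apply: (smooth_continuous (f := tmul y)) => //.
  apply: (@smooth_screw_mul _ _ _ _ (fun _ => y) id) => i; first exact: smooth_cst.
  exact: smooth_coord.
apply/seteqP; split=> [t [/= Wt yt]|_ ->] /=.
  apply: (@screw_mul_inj _ 3 y invr3_neq0).
  have : (W `&` proj @^-1` [set proj y]) (tmul y t).
    by split=> //=; rewrite -twisted_actE.
  by rewrite W2.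
split; last by rewrite twisted_actE.
exact: nbhs_singleton W1.
Qed.

(** Used for both actions: each is transitive, so both foliations have a single leaf. *)
Lemma transitive_orbit (m : M) (a p : R) (rho : M -> screw R -> M) : a != 0 ->
  (forall x s, rho (proj x) s = proj (screw_mul a p x s)) ->
  Defs.orbit (S := screw_lie) rho m = setT.
Proof.
move=> a0 rhoE; apply/seteqP; split=> // n _.
have [s sE] := @screw_mul_surj a p (repr m) (repr n) a0.
by exists s => //; rewrite -(coset_proj_repr m) rhoE sE coset_proj_repr.
Qed.

Lemma coset_actE' (x s : screw R) :
  coset_act (proj x) s = proj (screw_mul 1 1 x s).
Proof. exact: coset_actE. Qed.

(** Commuting with (1, 0) forces z = -z, and commuting with (0, 1) forces sin(pi t) = 0. A central
    element in the lattice acts trivially on the quotient, which is the purpose of the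
    conclusion. *)
Lemma screw_center_int (y : screw R) :
  (forall x : screw R, (x * y = y * x)%g) -> int_points y.
Proof.
move=> yC.
have := yC (vec3 0 1 0); have := yC (vec3 1 0 0); rewrite !screw_mulgE.
move=> /rowP e1 /rowP e2.
have := e1 i1; have := e1 i2; have := e2 i2.
rewrite !vec3E !(mulr0, mul0r, mul1r, mulr1, cospi, sinpi, cos0, sin0).
rewrite !(subr0, addr0, add0r) => s0 y2 y1.
have t0 : y 0 i0 \is a Num.int.
  apply: sin_eq0_int; lra.
have {}y1 : y 0 i1 = 0 by lra.
have {}y2 : y 0 i2 = 0 by lra.
by apply: ord3P; rewrite ?y1 ?y2 ?rpred0.
Qed.

Lemma not_parameter_rigid :
  ~ parameter_rigid (coset_atlas (S := screw_lie) int_lattice)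
      (@coset_act (screw_lie (R:=R)) int_lattice).
Proof.
move=> /(_ twisted_act)[].
- split; [exact: right_action_twisted|exact: smooth_twisted|].
  exact: twisted_locally_free.
- move=> x; rewrite (transitive_orbit _ invr3_neq0 twisted_actE).
  by rewrite (transitive_orbit _ (oner_neq0 R) coset_actE').
move=> Phi [F [[[_ [Psi [_ PhiK PsiK]]] PhiM] [_ [G [_ FK GK]]] FPhi _ _]].
(* A rotation by 2 pi without translation, hence central. *)
pose z : screw R := vec3 2 0 0.
have zC (x : screw R) : (x * z = z * x)%g.
  have c2 : cos (pi * 2) = 1 :> R by rewrite mulr_natr cos2pi.
  have s2 : sin (pi * 2) = 0 :> R by rewrite mulr_natr sin2pi.
  rewrite !screw_mulgE; apply: row3P;
    rewrite /screw_mul !vec3E ?mul1r ?c2 ?s2; ring.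
(* The inverse automorphism sends [z] to a central element, which lies in the lattice. *)
have yC (x : screw R) : (x * Psi z = Psi z * x)%g.
  by apply: (can_inj PhiK); rewrite !PhiM PsiK zC.
have Gy := screw_center_int yC.
(* [Psi z] acts trivially by right multiplication, and [F] carries this to a trivial competing
   action of [Phi (Psi z)], which is [z]. *)
have fixz (n : M) : twisted_act n z = n.
  rewrite -(GK n) -{1}(PsiK z) -FPhi; congr (F _).
  rewrite -(coset_proj_repr (G n)) coset_actE.
  by rewrite yC coset_proj_mul.
(* In the competing action [z] shifts time by 2/3, which is not an integer. *)
have := fixz (proj 1%g); rewrite twisted_actE => /coset_projP[g Gg].
rewrite mulg1 => gE; have := Gg i0; rewrite -gE vec3E mxE add0r vec3E.
move=> /int_eq0; have : (3^-1 * 2 : R) < 1 by lra.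
rewrite ger0_norm; last by lra.
by move=> -> /(_ isT); lra.
Qed.

End CompetingAction.

(** * Closed 1-forms on the quotient *)

Section Cohomology.
Context {R : realType}.
Local Notation proj := (coset_proj (@int_lattice R)).
Local Notation A := (coset_atlas (S := screw_lie) (@int_lattice R)).
Local Notation e0 := (delta_mx 0 i0 : 'rV[R]_3).

(** The diagonal entries of the Jacobian of left translation by a lattice element. *)
Definition lattice_sign (g : screw R) (i : 'I_3) : R :=
  if i == i0 then 1 else cos (pi * (g : 'rV[R]_3) 0 i0).

Lemma lattice_mulE (g x : screw R) i : int_points g ->
  (g * x)%g 0 i = (g : 'rV[R]_3) 0 i + lattice_sign g i * (x : 'rV[R]_3) 0 i.
Proof.
move=> Gg; rewrite int_points_mulE//; move: i.
by apply: ord3P; rewrite vec3E /lattice_sign /= ?mul1r.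
Qed.

Lemma near_jacobian n m (f g : 'rV[R]_n -> 'rV[R]_m) v :
  (\forall u \near v, f u = g u) -> jacobian_mx f v = jacobian_mx g v.
Proof.
move=> fg; apply/matrixP => i j; rewrite !mxE; apply: near_eq_derive.
by apply: filterS fg => u ->.
Qed.

Lemma delta_coord (i k : 'I_3) : (delta_mx 0 i : 'rV[R]_3) 0 k = (k == i)%:R.
Proof. by rewrite mxE eqxx. Qed.

Lemma jacobian_lmul (g : screw R) v i k : int_points g ->
  jacobian_mx (fun u : 'rV[R]_3 => (g * (u : screw R))%g : 'rV[R]_3) v i k =
  lattice_sign g k * (k == i)%:R.
Proof.
move=> Gg; rewrite mxE /partial.
rewrite (_ : (fun u => _) = (fun u : 'rV[R]_3 =>
    (g : 'rV[R]_3) 0 k + lattice_sign g k *: u 0 k)); last first.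
  by apply/funext => u; rewrite lattice_mulE.
have d := @is_deriveZ R _ R _ (lattice_sign g k) v (delta_mx 0 i) _
  (is_derive_coord k (delta_mx 0 i) v).
have := is_deriveD (is_derive_cst ((g : 'rV[R]_3) 0 k) v (delta_mx 0 i)) d.
by move=> [_]; rewrite delta_coord add0r; exact.
Qed.

Lemma near_lmul_form (f : 'rV[R]_3 -> 'rV[R]_3) (g : screw R) v (l : 'rV[R]_3) i :
  int_points g -> (\forall u \near v, f u = (g * (u : screw R))%g) ->
  (l *m (jacobian_mx f v)^T) 0 i = lattice_sign g i * l 0 i.
Proof.
move=> Gg /near_jacobian ->; rewrite mxE (bigD1 i)//= mxE jacobian_lmul// eqxx mulr1.
rewrite big1 ?addr0 1?mulrC// => k ki.
by rewrite mxE jacobian_lmul// (negbTE ki) !mulr0.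
Qed.

(** A chart centred at each point, inverting the projection on a small ball; off its domain [xget]
    returns the default [v]. *)
Definition ball_chart (v : screw R) : chart R (coset_space int_lattice) 3 :=
  Chart (proj @` ball (v : 'rV[R]_3) (1 / 2))
    (fun m => xget v [set x : screw R | ball (v : 'rV[R]_3) (1 / 2) x /\ proj x = m])
    (fun x => proj x).

Lemma ball_chart_mapE (v x : screw R) : ball (v : 'rV[R]_3) (1 / 2) x ->
  chart_map (ball_chart v) (proj x) = x.
Proof.
move=> vx /=; case: xgetP => [y _ [vy yx]|/(_ x)]; last by case.
exact: proj_ball_inj vy vx yx.
Qed.

Lemma ball_chart_atlas v : A (ball_chart v).
Proof.
exists id_chart, (ball (v : 'rV[R]_3) (1 / 2)); split => //.
- by apply: (@ball_open R 'rV[R]_3 v); lra.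
- by move=> x y vx vy; exact: proj_ball_inj vx vy.
- by move=> x vx; rewrite ball_chart_mapE.
Qed.

Lemma ball_chart_center (v : screw R) : ball (v : 'rV[R]_3) (1 / 2) v.
Proof. by apply: ballxx; lra. Qed.

Lemma ball_chart_img v : chart_img (ball_chart v) = ball (v : 'rV[R]_3) (1 / 2).
Proof.
rewrite /chart_img; apply/seteqP; split=> [_ [_ [x vx <-] <-]|x vx].
  by rewrite ball_chart_mapE.
by exists (proj x); [exists x|rewrite ball_chart_mapE].
Qed.

(** Changes of coordinates on the quotient are locally lattice translations, so the components of a
    form change only by signs and by a translation of the argument. *)
Lemma transition_near (c d : chart R (coset_space int_lattice) 3) (x : screw R) :
  A c -> A d -> chart_img c x -> chart_dom d (proj x) ->
  exists g : screw R, [/\ int_points g, transport_dom c d id x,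
    transport c d id x = (g * x)%g &
    \forall u \near x, transport c d id u = (g * (u : screw R))%g].
Proof.
move=> Ac Ad cx dx.
have [g Gg gE] := @local_lift R _ idfun x d (@cvg_id _ (nbhs x)) Ad dx.
have [V [oV _ [domc imgc] cV cI]] := coset_atlasP Ac.
rewrite imgc in cx.
have near_g : \forall u \near x, transport c d id u = (g * (u : screw R))%g.
  have : \forall u \near x, V u by exact: open_nbhs_nbhs.
  by apply: filterS2 gE => u gE Vu; rewrite /transport /= cI// gE.
exists g; split=> //; last exact: nbhs_singleton near_g.
by exists (proj x); [split=> //; rewrite domc; exists x|exact: cV].
Qed.

(** * The potential of a closed form and its periods *)

Section ClosedForm.
Variable w : components R (coset_space (@int_lattice R)) 3.
Hypothesis w_form : one_form A w.
Hypothesis w_closed : closed_form A w.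

Lemma form_transition c d (x : screw R) :
  A c -> A d -> chart_img c x -> chart_dom d (proj x) ->
  exists g : screw R, [/\ int_points g, chart_map d (proj x) = (g * x)%g &
    forall i, w c x 0 i = lattice_sign g i * w d (g * x)%g 0 i].
Proof.
move=> Ac Ad cx dx; have [g [Gg tx txE gE]] := transition_near Ac Ad cx dx.
have [V [_ _ [_ imgc] _ cI]] := coset_atlasP Ac.
exists g; split=> // [|i].
  by rewrite -txE /transport /= cI// -imgc.
by have [_ /(_ c d Ac Ad x tx) ->] := w_form; rewrite (near_lmul_form _ _ Gg gE) txE.
Qed.

(** The two charts give the same coordinates [x] to the point, so the lattice element relating them
    is 1 there. *)
Lemma form_chart_indep c d (x : screw R) :
  A c -> A d -> chart_img c x -> chart_img d x -> w c x = w d x.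
Proof.
move=> Ac Ad cx dx; have [V [_ _ [domd imgd] dV _]] := coset_atlasP Ad.
rewrite imgd in dx.
have [|g [Gg gx wE]] := form_transition Ac Ad cx; first by rewrite domd; exists x.
have g1 : g = 1%g.
  by apply: (@mulIg _ x); rewrite mul1g -gx dV.
apply/rowP => i; rewrite wE g1 mul1g /lattice_sign mxE mulr0 cos0.
by case: ifP; rewrite mul1r.
Qed.

(** The pullback of [w] to S. The chart moves with the point, which is harmless because the
    components at a point do not depend on the sheet containing it. *)
Definition lifted_form (i : 'I_3) (v : 'rV[R]_3) : R := w (ball_chart v) v 0 i.

Lemma lifted_formE c (x : screw R) i : A c -> chart_img c x ->
  lifted_form i x = w c x 0 i.
Proof.
move=> Ac cx; rewrite /lifted_form (@form_chart_indep _ c)//.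
  exact: ball_chart_atlas.
by rewrite ball_chart_img; exact: ball_chart_center.
Qed.

Lemma lifted_form_near i (v : screw R) :
  \forall u \near v, lifted_form i u = w (ball_chart v) u 0 i.
Proof.
have : \forall u \near v, ball (v : 'rV[R]_3) (1 / 2) u.
  by apply: (@nbhsx_ballx R 'rV[R]_3 v); lra.
apply: filterS => u vu; apply: lifted_formE; first exact: ball_chart_atlas.
by rewrite ball_chart_img.
Qed.

Lemma lifted_form_smooth i : smoothf (lifted_form i).
Proof.
move=> k; apply: Ck_on_loc => v _.
exists (chart_img (ball_chart v)), (fun u => w (ball_chart v) u 0 i); split.
- by rewrite ball_chart_img; exact: ball_chart_center.
- by have [/(_ _ (ball_chart_atlas v))] := w_form; exact.
- exact: lifted_form_near.
Qed.

Lemma lifted_form_closed i j v :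
  partial i (lifted_form j) v = partial j (lifted_form i) v.
Proof.
rewrite /partial (near_eq_derive _ (lifted_form_near j v)).
rewrite (near_eq_derive _ (lifted_form_near i v)).
apply: (w_closed (ball_chart_atlas v)).
by rewrite ball_chart_img; exact: ball_chart_center.
Qed.

(** Invariance of the pullback under the lattice, seen by comparing the charts centred at [v] and at
    [g * v], which both contain the image of [v]. *)
Lemma lifted_form_equivariant (g v : screw R) i : int_points g ->
  lifted_form i v = lattice_sign g i * lifted_form i (g * v)%g.
Proof.
move=> Gg.
have [||||h [Gh hE wE]] := @form_transition (ball_chart v) (ball_chart (g * v)%g) v.
- exact: ball_chart_atlas.
- exact: ball_chart_atlas.
- by rewrite ball_chart_img; exact: ball_chart_center.
- exists (g * v)%g; first exact: ball_chart_center.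
  by rewrite coset_proj_mul.
have gh : g = h.
  have pv : proj (g * v)%g = proj v by exact: coset_proj_mul.
  apply: (@mulIg _ v); rewrite -hE -pv ball_chart_mapE//.
  exact: ball_chart_center.
by rewrite /lifted_form wE -gh.
Qed.

Local Notation F := (cone_potential lifted_form).

Lemma potential_derive v i : is_derive v (delta_mx 0 i) F (lifted_form i v).
Proof.
by apply: cone_potential_derive; [exact: lifted_form_smooth|exact: lifted_form_closed].
Qed.

Lemma lifted_form_continuous i : continuous (lifted_form i).
Proof. exact: (Ck_on_continuous (lifted_form_smooth i 0%N)). Qed.

Lemma potential_derive_dir v u :
  is_derive v u F (\sum_i u 0 i * lifted_form i v).
Proof.
exact: (is_derive_partials (fun i v => potential_derive v i) lifted_form_continuous).
Qed.

Lemma potential_continuous : continuous F.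
Proof.
exact: (partials_continuous (fun i v => potential_derive v i) lifted_form_continuous).
Qed.

Definition period (g : screw R) : R := F g - F 0.

(** The difference F(g u) - F(u) has zero partial derivatives because the pullback is lattice
    invariant; hence it is constant along the line from 0 to [v], and 0 is the unit of the group. *)
Lemma potential_lmul (g v : screw R) : int_points g ->
  F (g * v)%g = F v + period g.
Proof.
move=> Gg; pose D (u : 'rV[R]_3) := F (g * (u : screw R))%g - F u.
have D' i u : is_derive u (delta_mx 0 i) D 0.
  rewrite -(subrr (lifted_form i u)); apply: is_deriveB (potential_derive u i).
  refine (proj2 (@is_derive_along _ _ R _ _ _ _) _).
  (* Moving [u] along coordinate [i] moves [g * u] along the same coordinate, with its sign. *)
  have := proj1 (is_derive_along F (g * (u : screw R))%g
    (lattice_sign g i *: delta_mx 0 i) _) (potential_derive_dir _ _).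
  rewrite (bigD1 i)//= big1 ?addr0; last first.
    by move=> k ki; rewrite mxE delta_coord (negbTE ki) mulr0 mul0r.
  rewrite mxE delta_coord eqxx mulr1 -lifted_form_equivariant//.
  rewrite (_ : (fun h : R => F (h *: (lattice_sign g i *: delta_mx 0 i) + _)) =
    (fun h : R => F (g * ((h *: delta_mx 0 i + u)%R : screw R))%g))//.
  apply/funext => h; congr F; apply/rowP => k.
  rewrite [LHS]mxE !lattice_mulE// !mxE eqxx /=.
  by case: (eqVneq k i) => [->|_]; rewrite /=; ring.
have D0 : D v = D 0.
  have d0 (r : R) : is_derive r (1 : R) (fun r : R => D (r *: (v : 'rV[R]_3) + 0)) 0.
    apply: (proj1 (is_derive_line D 0 (v : 'rV[R]_3) r 0)).
    have := @is_derive_partials R 3 D (fun _ _ => 0) D' _ (r *: (v : 'rV[R]_3) + 0) v.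
    by rewrite big1 => [|k _]; [apply=> k; exact: cst_continuous|rewrite mulr0].
  by have := is_derive_0_is_cst 1 0 d0; rewrite scale1r scale0r !addr0.
have -> : period g = D 0 by rewrite /D /period mulg1.
by rewrite -D0 /D addrC subrK.
Qed.

Lemma periodM (g h : screw R) : int_points g -> int_points h ->
  period (g * h)%g = period g + period h.
Proof. by move=> Gg Gh; rewrite /period potential_lmul// /period; ring. Qed.

Lemma period1 : period 1%g = 0.
Proof. by rewrite /period subrr. Qed.

Lemma int_points_vec3 (x y z : R) : x \is a Num.int -> y \is a Num.int ->
  z \is a Num.int -> int_points (vec3 x y z).
Proof. by move=> *; apply: ord3P; rewrite vec3E. Qed.

Lemma vec3_mul (x y z x' y' z' : R) :
  ((vec3 x y z : screw R) * (vec3 x' y' z' : screw R))%g =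
  screw_mul 1 1 (vec3 x y z) (vec3 x' y' z').
Proof. by []. Qed.

(* Conjugation by (1, 0) sends (0, m) to (0, -m), so the period of (0, m) is its
   own opposite. *)
Lemma period_fiber (y z : R) : y \is a Num.int -> z \is a Num.int ->
  period (vec3 0 y z) = 0.
Proof.
move=> yi zi; have i0' : (0 : R) \is a Num.int by exact: rpred0.
have i1' : (1 : R) \is a Num.int by exact: rpred1.
have Gm := int_points_vec3 i0' yi zi.
have Gm' : int_points (vec3 0 (- y) (- z)) by apply: int_points_vec3; rewrite ?rpredN.
have Gt := int_points_vec3 i1' i0' i0'.
have E1 : ((vec3 1 0 0 : screw R) * (vec3 0 y z : screw R))%g =
    ((vec3 0 (- y) (- z) : screw R) * (vec3 1 0 0 : screw R))%g.
  by apply: row3P; rewrite vec3_mul !vec3E ?mulr1 ?mulr0 ?cospi ?sinpi ?cos0 ?sin0; ring.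
have E2 : ((vec3 0 (- y) (- z) : screw R) * (vec3 0 y z : screw R))%g = 1%g.
  by apply: row3P; rewrite vec3_mul [RHS]mxE !vec3E ?mulr1 ?mulr0 ?cos0 ?sin0; ring.
have := congr1 period E1; have := congr1 period E2.
rewrite !periodM// period1; lra.
Qed.

Definition time_period : R := period (vec3 1 0 0).

Lemma periodE (g : screw R) : int_points g ->
  period g = time_period * (g : 'rV[R]_3) 0 i0.
Proof.
move=> Gg; have i0' : (0 : R) \is a Num.int by exact: rpred0.
have i1' : (1 : R) \is a Num.int by exact: rpred1.
have gE : g = ((vec3 0 ((g : 'rV[R]_3) 0 i1) ((g : 'rV[R]_3) 0 i2) : screw R) *
    (vec3 ((g : 'rV[R]_3) 0 i0) 0 0 : screw R))%g.
  by apply: row3P; rewrite vec3_mul !vec3E ?mulr1 ?mulr0 ?cos0 ?sin0; ring.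
rewrite {1}gE periodM ?period_fiber ?add0r//; try exact: int_points_vec3.
have addP (x y : R) : x \is a Num.int -> y \is a Num.int ->
    period (vec3 (x + y) 0 0) = period (vec3 x 0 0) + period (vec3 y 0 0).
  move=> xi yi; rewrite -periodM//; try exact: int_points_vec3.
  congr period; apply: row3P; rewrite vec3_mul !vec3E; ring.
have natP (n : nat) : period (vec3 n%:R 0 0) = time_period * n%:R.
  elim: n => [|n IH].
    rewrite mulr0 (_ : vec3 _ _ _ = (1%g : screw R)) ?period1//.
    by apply: row3P; rewrite vec3E [RHS]mxE.
  by rewrite -natr1 addP ?natr_int// IH mulrDr mulr1.
have /intrP[m ->] := Gg i0; case: m => m; first exact: natP.
(* A negative integer and its opposite have periods that add up to the period of the unit, which is
   0. *)
have := addP (Negz m)%:~R m.+1%:R; rewrite intr_int natr_int => /(_ isT isT).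
rewrite NegzE mulrNz addrC subrr natP => E.
have : period (vec3 0 0 0) = 0 by exact: period_fiber.
rewrite mulrN; lra.
Qed.

Definition reduced_potential (v : 'rV[R]_3) : R := F v - time_period * v 0 i0.

Lemma reduced_potential_lmul (g v : screw R) : int_points g ->
  reduced_potential (g * v)%g = reduced_potential v.
Proof.
move=> Gg; rewrite /reduced_potential potential_lmul// periodE//.
by rewrite lattice_mulE// /lattice_sign /=; ring.
Qed.

(** The integral is differentiated only once; higher regularity is that of the partial derivatives,
    which are the components of the lifted form. *)
Lemma potential_smooth : smoothf F.
Proof.
move=> [|k]; first by split=> // v _; exact: potential_continuous.
apply: (@Ck_onS_is_derive _ _ _ _ lifted_form).
- exact: potential_continuous.
- by move=> i v; exact: potential_derive.
- by move=> i; exact: lifted_form_smooth.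
Qed.

Lemma reduced_potential_smooth : smoothf reduced_potential.
Proof.
apply: smoothD potential_smooth _; apply: smoothN; apply: smoothM.
  exact: smooth_cst.
exact: smooth_coord.
Qed.

Lemma reduced_potential_partial i v :
  partial i reduced_potential v = lifted_form i v - time_period * (i0 == i)%:R.
Proof.
have d := @is_deriveZ R _ R _ time_period v (delta_mx 0 i) _
  (is_derive_coord i0 (delta_mx 0 i) v).
by have [_] := is_deriveB (potential_derive v i) d; rewrite delta_coord; exact.
Qed.

Definition coset_potential (m : coset_space (@int_lattice R)) : R :=
  reduced_potential (repr m : screw R).

Lemma coset_potentialE (x : screw R) :
  coset_potential (proj x) = reduced_potential x.
Proof.
have [g Gg xE] := (coset_projP _ _ _).1 (coset_proj_repr (proj x)).
by rewrite /coset_potential xE reduced_potential_lmul.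
Qed.

Lemma coset_potential_near c (v : screw R) : A c -> chart_img c v ->
  \forall u \near v, (coset_potential \o chart_inv c) u = reduced_potential u.
Proof.
move=> /coset_atlasP[V [oV _ [_ imgc] _ cI]]; rewrite imgc => Vv.
have : \forall u \near v, V u by exact: open_nbhs_nbhs.
by apply: filterS => u Vu; rewrite /= cI// coset_potentialE.
Qed.

Lemma cohomologous_dt :
  cohomologous A w (fun _ _ => time_period *: e0).
Proof.
exists coset_potential.
  move=> c Ac k; apply: Ck_on_loc => v cv; exists setT, reduced_potential.
  by split=> //; [exact: reduced_potential_smooth|exact: coset_potential_near].
move=> c Ac v cv; apply/rowP => i; rewrite !mxE eqxx.
rewrite /partial (near_eq_derive _ (coset_potential_near Ac cv)).
rewrite -[X in _ + X]/(partial i reduced_potential v) reduced_potential_partial.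
by rewrite (lifted_formE i Ac cv) (eq_sym i) /=; ring.
Qed.

End ClosedForm.

(** Lattice translations have sign 1 on time, so [l] dt has the same components in all charts. *)
Lemma dt_related_id (l : R) : form_related A A id (fun _ _ => l *: e0) (fun _ _ => l *: e0).
Proof.
move=> c d Ac Ad v [m [cm dm] mv].
have [V [_ _ [domc imgc] cV cI]] := coset_atlasP Ac.
move: cm dm mv; rewrite domc => -[x Vx <-] dm; rewrite cV// => <-.
have [||g [Gg _ _ gE]] := @transition_near c d x Ac Ad => //.
  by rewrite imgc.
apply/rowP => i; rewrite (near_lmul_form _ _ Gg gE) [in RHS]mxE delta_coord.
by rewrite mxE delta_coord /lattice_sign; case: eqVneq; rewrite ?mul1r ?mulr0.
Qed.

Lemma dt_form (l : R) : one_form A (fun _ _ => l *: e0).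
Proof.
split; last exact: dt_related_id.
by move=> c _ j k; apply: Ck_onS (smooth_cst 3 _ k).
Qed.

End Cohomology.

(** * The left invariant form dt and its cocycle *)

Section InvariantForms.
Context {R : realType}.
Local Notation proj := (coset_proj (@int_lattice R)).
Local Notation A := (coset_atlas (S := screw_lie) (@int_lattice R)).
Local Notation e0 := (delta_mx 0 i0 : 'rV[R]_3).

Lemma dt_related_proj (l : R) :
  form_related (lie_atlas (screw_lie (R:=R))) A proj
    (fun _ _ => l *: e0) (fun _ _ => l *: e0).
Proof.
move=> _ d -> Ad v [x [_ dx] /= <-].
have [g Gg gE] := @local_lift R _ idfun x d (@cvg_id _ (nbhs x)) Ad dx.
apply/rowP => i; rewrite (near_lmul_form _ _ Gg gE) [in RHS]mxE delta_coord.
by rewrite mxE delta_coord /lattice_sign; case: eqVneq; rewrite ?mul1r ?mulr0.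
Qed.

Lemma dt_form_lie (l : R) :
  one_form (lie_atlas (screw_lie (R:=R))) (fun _ _ => l *: e0).
Proof.
split; first by move=> c _ j k; apply: Ck_onS (smooth_cst 3 _ k).
move=> _ _ -> -> v _.
have near_id : \forall u \near v, transport id_chart id_chart id u =
    (1 * (u : screw R))%g.
  by apply: filterE => u; rewrite mul1g.
apply/rowP => i; rewrite (near_lmul_form _ _ (@int_points1 R) near_id) [in RHS]mxE delta_coord.
by rewrite mxE delta_coord /lattice_sign; case: eqVneq; rewrite ?mul1r ?mulr0.
Qed.

(** Left translations add a constant to time, so they preserve dt, and dt is constant on a left
    invariant field. *)
Lemma lie_algebra_time X : lie_algebra (S := screw_lie (R:=R)) X ->
  forall v, X id_chart v 0 i0 = X id_chart 0 0 i0.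
Proof.
move=> [_ Xinv] v; pose g : screw R := v.
have := Xinv g id_chart id_chart erefl erefl 0; rewrite /transport /=.
rewrite (mulg1 g) => -> //; last by exists (1%g : screw R).
rewrite mxE (bigD1 i0)//= big1 ?addr0.
  rewrite mxE /partial (_ : (fun u => _) = (fun u : 'rV[R]_3 => g 0 i0 + u 0 i0)).
    have := is_deriveD (is_derive_cst ((g : 'rV[R]_3) 0 i0) (0 : 'rV[R]_3) (delta_mx 0 i0))
      (is_derive_coord i0 (delta_mx 0 i0) (0 : 'rV[R]_3)).
    move=> [_]; rewrite add0r delta_coord eqxx => H.
    by rewrite [X in _ * X]H mulr1.
  by apply/funext => u; rewrite screw_mulgE vec3E mul1r.
move=> k k0; rewrite mxE /partial (_ : (fun u => _) = (fun u : 'rV[R]_3 => g 0 i0 + u 0 i0)).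
  have := is_deriveD (is_derive_cst ((g : 'rV[R]_3) 0 i0) (0 : 'rV[R]_3) (delta_mx 0 k))
    (is_derive_coord i0 (delta_mx 0 k) (0 : 'rV[R]_3)).
  move=> [_]; rewrite add0r delta_coord eq_sym (negbTE k0) => H.
  by rewrite [X in _ * X]H mulr0.
by apply/funext => u; rewrite screw_mulgE vec3E mul1r.
Qed.

Definition dt_cocycle (l : R) (X : components R (screw R) 3) : R :=
  l * X id_chart 0 0 i0.

(** The time component of a bracket only involves derivatives of the time components, which are
    constant. *)
Lemma dt_lie_cocycle (l : R) : lie_cocycle (S := screw_lie (R:=R)) (dt_cocycle l).
Proof.
split=> [a X Y _ _|X Y lX lY]; first by rewrite /dt_cocycle !mxE; ring.
rewrite /dt_cocycle /bracket.
have Z (Z1 Z2 : components R (screw R) 3) : lie_algebra (S := screw_lie (R:=R)) Z2 ->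
    (Z1 id_chart 0 *m jacobian_mx (Z2 id_chart) 0) 0 i0 = 0 :> R.
  move=> lZ; rewrite mxE big1// => k _; rewrite mxE /partial.
  rewrite (_ : (fun u => _) = cst (Z2 id_chart 0 0 i0)) ?derive_cst ?mulr0//.
  by apply/funext => u; rewrite (lie_algebra_time lZ).
by rewrite mxE (Z X Y lY) mxE (Z Y X lX) oppr0 addr0 mulr0.
Qed.

Lemma dt_invariant_form (l : R) : invariant_form_of (S := screw_lie (R:=R))
  (dt_cocycle l) (fun _ _ => l *: e0).
Proof.
split; first exact: dt_form_lie.
move=> X lX _ -> v _; rewrite /pairing /dt_cocycle (bigD1 i0)//= big1 ?addr0.
  by rewrite mxE delta_coord eqxx mulr1 (lie_algebra_time lX).
by move=> i ii; rewrite mxE delta_coord (negbTE ii) mulr0 mul0r.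
Qed.

Lemma H1_int_lattice :
  H1_coset_eq_H1_lie (S := screw_lie (R:=R)) (@int_lattice R).
Proof.
move=> w w_form w_closed; pose l := time_period w.
exists (dt_cocycle l), (fun _ _ => l *: e0), (fun _ _ => l *: e0); split.
- exact: dt_lie_cocycle.
- exact: dt_invariant_form.
- exact: dt_form.
- exact: dt_related_proj.
- exact: cohomologous_dt.
Qed.

End InvariantForms.

(** * Integration of periodic functions *)

Section PeriodicIntegral.
Local Open Scope ereal_scope.
Context {R : realType}.
Local Notation mu := (@lebesgue_measure R).
Local Notation RR := (measurableTypeR R).

Lemma measurable_addr (a : R) : measurable_fun [set: RR] (fun x : RR => (x + a)%R : RR).
Proof. exact: measurable_funD. Qed.

Lemma addr_preimage_itv (a b c : R) (bl br : bool) :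
  (fun x : R => x + a)%R @^-1` [set` Interval (BSide bl b) (BSide br c)] =
  [set` Interval (BSide bl (b - a)%R) (BSide br (c - a)%R)].
Proof.
apply/seteqP; split=> x /=; rewrite !in_itv /= => /andP[h1 h2]; apply/andP; split;
  case: bl br h1 h2 => -[] /= h1 h2; lra.
Qed.

(** By uniqueness of the Lebesgue measure it is enough to compare lengths of half-open intervals. *)
Lemma lebesgue_measure_addr (a : R) (A : set R) : measurable A ->
  pushforward mu (fun x : RR => (x + a)%R : RR) A = mu A.
Proof.
move=> mA; apply/esym.
apply: (lebesgue_measure_unique (mu := pushforward mu (fun x : RR => (x + a)%R : RR)
  : {measure set _ -> \bar R})) => //.
- exact: measurable_addr.
move=> mf _ [[b c] _ <-] /=; rewrite /pushforward addr_preimage_itv.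
rewrite !lebesgue_measure_itv /= !lte_fin ltrD2r -!EFinB.
by rewrite (_ : c - a - (b - a) = c - b)%R//; ring.
Qed.

Lemma ge0_integral_addr (a : R) (D : set R) (f : R -> \bar R) :
  measurable D -> measurable_fun setT f -> (forall x, 0 <= f x) ->
  \int[mu]_(x in D) f x = \int[mu]_(x in (fun x => x + a)%R @^-1` D) f (x + a)%R.
Proof.
move=> mD mf f0.
have := @ge0_integral_pushforward _ _ _ _ _ _ (measurable_addr a) mu D f mD.
move=> <-//; last exact: measurable_funS mf.
apply: eq_measure_integral => [|mf' A mA _]; first exact: measurable_addr.
exact: (esym (lebesgue_measure_addr a mA)).
Qed.

(** Once [a] is reduced modulo [L], the window [a, L + a[ is cut at [L] and the part beyond [L] is
    moved back by one period. *)
Lemma periodic_integral (L a : R) (f : R -> \bar R) : (0 < L)%R ->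
  measurable_fun setT f -> (forall x, 0 <= f x) -> (forall x, f (x + L)%R = f x) ->
  \int[mu]_(x in `[0%R, L[) f (x + a)%R = \int[mu]_(x in `[0%R, L[) f x.
Proof.
move=> L0 mf f0 fL.
have fz (k : int) x : f (x + L * k%:~R)%R = f x.
  have fn (n : nat) y : f (y + L * n%:R)%R = f y.
    elim: n y => [|n IH] y; first by rewrite mulr0 addr0.
    by rewrite -natr1 mulrDr mulr1 addrA fL IH.
  case: k => n; first exact: fn.
  by rewrite NegzE mulrNz mulrN -[LHS](fn n.+1) subrK.
wlog aL : a / (0 <= a < L)%R.
  move=> H; pose k := Num.floor (a / L)%R; pose r := (a - L * k%:~R)%R.
  have aE : a = (r + L * k%:~R)%R by rewrite /r subrK.
  transitivity (\int[mu]_(x in `[0%R, L[) f (x + r)%R).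
    by apply: eq_integral => x _; rewrite [in LHS]aE addrA fz.
  apply: H; have kle := floor_le (a / L); have klt := floorD1_gt (a / L).
  rewrite ler_pdivlMr// in kle; rewrite ltr_pdivrMr// intrD in klt.
  by rewrite /r /k; apply/andP; split; lra.
have /andP[a0 aL'] := aL.
have split_itv (b c d : R) : (b <= c <= d)%R ->
    \int[mu]_(x in `[b, d[) f x =
    \int[mu]_(x in `[b, c[) f x + \int[mu]_(x in `[c, d[) f x.
  move=> /andP[bc cd].
  rewrite -ge0_integral_setU//; last first.
  - by apply/disj_setPS => x /= []; rewrite !in_itv /= => /andP[_ xc] /andP[cx _]; lra.
  - exact: measurable_funS mf.
  congr integral; apply/seteqP; split => x /=; rewrite !in_itv /=.
    by move=> /andP[bx xd]; case: (ltP x c) => xc; [left|right]; rewrite ?bx ?xd.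
  by case=> /andP[h1 h2]; apply/andP; split; lra.
have -> : \int[mu]_(x in `[0%R, L[) f (x + a)%R = \int[mu]_(x in `[a, (L + a)%R[) f x.
  rewrite (ge0_integral_addr a (D := `[a, (L + a)%R[))// addr_preimage_itv.
  by rewrite subrr addrK.
rewrite (split_itv a L) ?(ltW aL') ?lerDl// (split_itv 0%R a L) ?a0 ?(ltW aL')//.
rewrite addeC; congr (_ + _).
rewrite (ge0_integral_addr L (D := `[L, (L + a)%R[))// addr_preimage_itv subrr.
by rewrite (addrC L) addrK; apply: eq_integral => x _; rewrite fL.
Qed.

Variables (L : R) (L0 : (0 < L)%R).

Lemma measurable_period : measurable (`[0%R, L[%classic : set RR).
Proof. exact: measurable_itv. Qed.

Lemma period_lty : mu `[0%R, L[%classic < +oo.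
Proof. by rewrite lebesgue_measure_itv /= lte_fin L0 -EFinB ltry. Qed.

(** Models the circle of length [L] by a finite measure on the whole line, concentrated on a
    fundamental interval; sets and functions on the circle are the [L]-periodic ones. *)
Definition circle_measure : set RR -> \bar R := mfrestr measurable_period period_lty.

HB.instance Definition _ := FiniteMeasure.on circle_measure.

Lemma circle_measureT : circle_measure setT = L%:E.
Proof.
by rewrite /circle_measure /mfrestr /mrestr setTI lebesgue_measure_itv /= lte_fin L0 sube0.
Qed.

Lemma integral_circle (f : R -> \bar R) : measurable_fun setT f -> (forall x, 0 <= f x) ->
  \int[circle_measure]_x f x = \int[mu]_(x in `[0%R, L[) f x.
Proof.
move=> mf f0.
rewrite -(setUv (`[0%R, L[%classic : set RR)) ge0_integral_setU//=.
- rewrite [X in _ + X]null_set_integral ?adde0.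
  + apply: eq_measure_integral => A mA AL.
    by rewrite /= /circle_measure /mfrestr /mrestr setIidl.
  + exact: measurableC.
  + exact: measurable_funS mf.
  + by rewrite /= /circle_measure /mfrestr /mrestr setICl measure0.
- exact: measurableC.
- exact: measurable_funS mf.
- exact/disj_setPCl.
Qed.

Lemma circle_integral_addr (a : R) (f : R -> \bar R) :
  measurable_fun setT f -> (forall x, 0 <= f x) -> (forall x, f (x + L)%R = f x) ->
  \int[circle_measure]_x f (x + a)%R = \int[circle_measure]_x f x.
Proof.
move=> mf f0 fL; rewrite !integral_circle//; first exact: periodic_integral.
exact: measurableT_comp mf (measurable_addr a).
Qed.

Lemma circle_measure_addr (a : R) (D : set R) : measurable D ->
  (forall x, D (x + L)%R <-> D x) ->
  circle_measure ((fun x => x + a)%R @^-1` D) = circle_measure D.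
Proof.
move=> mD DL; have mDa : measurable ((fun x : RR => x + a)%R @^-1` D : set RR).
  by rewrite -[X in measurable X]setTI; exact: measurable_addr.
have E (B : set RR) : measurable B ->
    circle_measure B = \int[circle_measure]_x (\1_B x)%:E.
  by move=> mB; rewrite integral_indic// setIT.
rewrite !E//.
have m1 : measurable_fun [set: R] (fun x : R => (\1_D x : R)%:E).
  exact/measurable_EFinP/measurable_indic.
rewrite -(circle_integral_addr a m1)//.
move=> x; rewrite !indicE.
suff -> : ((x + L)%R \in D) = (x \in D) by [].
by apply/idP/idP => /set_mem/DL; exact: mem_set.
Qed.

End PeriodicIntegral.

(** * The invariant measure *)

Section LatticeMeasure.
Local Open Scope ereal_scope.
Context {R : realType}.
Local Notation RR := (measurableTypeR R).
Local Notation proj := (coset_proj (@int_lattice R)).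
Local Notation M := (borel (coset_space (@int_lattice R))).

Lemma continuous_borel_measurable (T U : ptopologicalType) (f : T -> U) :
  continuous f -> measurable_fun setT (f : borel T -> borel U).
Proof.
move=> cf; apply: (@measurability _ _ (borel T) (borel U) setT f (@open U)) => // _ [V oV <-].
rewrite setTI; apply: sub_sigma_algebra; apply: open_comp => // x _; exact: cf.
Qed.

(* The time circle has length 2, not 1: the translation by 2 of the time
   coordinate is an element of the lattice with no reflection of the fibre. *)
Definition time_measure := circle_measure (ltr0Sn R 1).
Definition fiber_measure := circle_measure (@ltr01 R).

HB.instance Definition _ := FiniteMeasure.on time_measure.
HB.instance Definition _ := FiniteMeasure.on fiber_measure.

Definition box_measure : set (RR * RR * RR) -> \bar R :=
  (time_measure \x fiber_measure) \x fiber_measure.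

HB.instance Definition _ := Measure.on box_measure.

(** On the box [0, 2[ x [0, 1[ x [0, 1[ this map is two-to-one onto the quotient, as the box is a
    fundamental domain for the subgroup 2Z x Z[i] of index 2. *)
Definition cover (p : RR * RR * RR) : M := proj (vec3 p.1.1 p.1.2 p.2).

(** The source carries a product sigma-algebra, so the preimage of an open set is written as a
    countable union of rational boxes, which are products of intervals. *)
Lemma measurable_cover : measurable_fun setT cover.
Proof.
apply: (@measurability _ _ _ M setT cover (@open (coset_space (@int_lattice R)))) => // _ [V oV <-].
rewrite setTI; have oW : open (proj @^-1` V).
  by apply: open_comp oV => x _; exact: coset_proj_continuous.
(* Boxes that do not fit are replaced by [set0], so that the union runs over a whole countable
   type. *)
pose F (lr : 'rV[rat]_3 * 'rV[rat]_3) : set (RR * RR * RR) :=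
  if `[< rat_box lr.1 lr.2 `<=` proj @^-1` V >] then
    [set p | rat_box lr.1 lr.2 (vec3 p.1.1 p.1.2 p.2)] else set0.
rewrite (_ : cover @^-1` V = \bigcup_lr F lr).
  apply: countable_bigcupT_measurable => [|lr]; first exact: countableP.
  rewrite /F; case: asboolP => // _.
  pose I j : set RR := `](ratr (lr.1 ord0 j))%R, (ratr (lr.2 ord0 j))%R[%classic.
  rewrite (_ : [set p | _] = (I i0 `*` I i1) `*` I i2).
    by apply: measurableX; [apply: measurableX|]; exact: measurable_itv.
  apply/seteqP; split=> [[[t x] y] /= H|[[t x] y] /= [[H0 H1] H2]].
    have := H i0; have := H i1; have := H i2; rewrite !vec3E /= => h2 h1 h0.
    by rewrite /I /= !in_itv.
  by apply: ord3P; rewrite vec3E; [move: H0|move: H1|move: H2]; rewrite /I /= in_itv.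
apply/seteqP; split=> [p Vp|p [lr _]]; last first.
  by rewrite /F; case: asboolP => // sub /sub.
have [l [r [xlr sub]]] := open_rat_boxP oW (Vp : (proj @^-1` V) (vec3 p.1.1 p.1.2 p.2)).
by exists (l, r) => //; rewrite /F; case: asboolP.
Qed.

Definition lattice_measure (A : set M) : \bar R := box_measure (cover @^-1` A).

Let lattice_measure0 : lattice_measure set0 = 0.
Proof. by rewrite /lattice_measure preimage_set0 measure0. Qed.

Let lattice_measure_ge0 A : 0 <= lattice_measure A.
Proof. exact: measure_ge0. Qed.

Let lattice_measure_sigma_additive : semi_sigma_additive lattice_measure.
Proof.
suff : semi_sigma_additive (pushforward box_measure cover) by [].
apply: measure_semi_sigma_additive; exact: measurable_cover.
Qed.

HB.instance Definition _ := isMeasure.Build _ _ _ lattice_measure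
  lattice_measure0 lattice_measure_ge0 lattice_measure_sigma_additive.

Lemma lattice_measureT : lattice_measure setT = 2%:E.
Proof.
rewrite /lattice_measure preimage_setT /box_measure.
transitivity ((time_measure \x fiber_measure) setT * fiber_measure setT).
  by rewrite -setXTT; exact: product_measure1E.
have -> : (time_measure \x fiber_measure) setT = time_measure setT * fiber_measure setT.
  by rewrite -setXTT; exact: product_measure1E.
by rewrite [time_measure _]circle_measureT [fiber_measure _]circle_measureT !mule1.
Qed.

Let lattice_measure_fin : fin_num_fun lattice_measure.
Proof. by apply: lty_fin_num_fun; rewrite /= lattice_measureT ltry. Qed.

HB.instance Definition _ := Measure_isFinite.Build _ _ _ lattice_measure
  lattice_measure_fin.

Definition fiber_section (A : set M) (t x : R) : \bar R :=
  fiber_measure [set y | A (proj (vec3 t x y))].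

Lemma fiber_sectionE A t x :
  fiber_section A t x = fiber_measure (xsection (cover @^-1` A) (t, x)).
Proof. by congr fiber_measure; apply/seteqP; split=> y; rewrite /xsection /= in_setE. Qed.

Section Sections.
Variables (A : set M) (mA : measurable A).

Lemma measurable_cover_preimage : measurable (cover @^-1` A).
Proof. by rewrite -[X in measurable X]setTI; exact: measurable_cover. Qed.

Lemma measurable_fiber_section :
  measurable_fun setT (fun p : RR * RR => fiber_section A p.1 p.2).
Proof.
have := measurable_fun_xsection fiber_measure measurable_cover_preimage.
move=> H; rewrite (_ : (fun p => _) = fiber_measure \o xsection (cover @^-1` A))//.
by apply/funext => -[t x]; exact: fiber_sectionE.
Qed.

Lemma fiber_section_ge0 t x : 0 <= fiber_section A t x.
Proof. exact: measure_ge0. Qed.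

Lemma measurable_fiber_section_x t : measurable_fun setT (fiber_section A t : RR -> _).
Proof. exact: (measurable_fun_pair2 t measurable_fiber_section). Qed.

Lemma lattice_measureE : lattice_measure A =
  \int[time_measure]_t \int[fiber_measure]_x fiber_section A t x.
Proof.
transitivity (\int[time_measure \x fiber_measure]_p fiber_section A p.1 p.2).
  by apply: eq_integral => -[t x] _; rewrite fiber_sectionE.
apply: (fubini_tonelli1 _ measurable_fiber_section) => p.
exact: fiber_section_ge0.
Qed.

Lemma proj_addr_x t x y : proj (vec3 t (x + 1)%R y) = proj (vec3 t x y).
Proof.
have G : int_points (vec3 0%R 1%R 0%R : screw R).
  by apply: ord3P; rewrite vec3E ?rpred0 ?rpred1.
rewrite -(coset_proj_mul (Gamma := int_lattice) (vec3 t x y : screw R) G).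
by congr (proj _); rewrite int_points_mulE// !vec3E mulr0 cos0;
  apply: row3P; rewrite !vec3E; ring.
Qed.

Lemma proj_addr_y t x y : proj (vec3 t x (y + 1)%R) = proj (vec3 t x y).
Proof.
have G : int_points (vec3 0%R 0%R 1%R : screw R).
  by apply: ord3P; rewrite vec3E ?rpred0 ?rpred1.
rewrite -(coset_proj_mul (Gamma := int_lattice) (vec3 t x y : screw R) G).
by congr (proj _); rewrite int_points_mulE// !vec3E mulr0 cos0;
  apply: row3P; rewrite !vec3E; ring.
Qed.

Lemma proj_addr_t t x y : proj (vec3 (t + 2)%R x y) = proj (vec3 t x y).
Proof.
have G : int_points (vec3 2%R 0%R 0%R : screw R).
  by apply: ord3P; rewrite vec3E ?rpred0 ?rpred_nat.
rewrite -(coset_proj_mul (Gamma := int_lattice) (vec3 t x y : screw R) G).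
by congr (proj _); rewrite int_points_mulE// !vec3E mulr_natr cos2pi;
  apply: row3P; rewrite !vec3E; ring.
Qed.

Lemma fiber_section_translate (t x a : R) :
  fiber_measure [set y | A (proj (vec3 t x (y + a)%R))] = fiber_section A t x.
Proof.
apply: (@circle_measure_addr _ _ ltr01 a [set y | A (proj (vec3 t x y))]).
  rewrite (_ : [set y | _] = xsection (cover @^-1` A) (t, x)).
    by apply: measurable_xsection; exact: measurable_cover_preimage.
  by apply/seteqP; split=> y; rewrite /xsection /= in_setE.
by move=> y; rewrite /= proj_addr_y.
Qed.

Lemma fiber_integral_translate (t a : R) :
  \int[fiber_measure]_x fiber_section A t (x + a)%R =
  \int[fiber_measure]_x fiber_section A t x.
Proof.
apply: circle_integral_addr; first exact: measurable_fiber_section_x.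
  exact: fiber_section_ge0.
by move=> x; congr fiber_measure; apply/seteqP; split=> y /=; rewrite proj_addr_x.
Qed.

Lemma time_integral_translate (a : R) :
  \int[time_measure]_t \int[fiber_measure]_x fiber_section A (t + a)%R x =
  \int[time_measure]_t \int[fiber_measure]_x fiber_section A t x.
Proof.
apply: (@circle_integral_addr _ _ _ a
  (fun t => \int[fiber_measure]_x fiber_section A t x)).
- apply: (measurable_fun_fubini_tonelli_F _ measurable_fiber_section) => p.
  exact: fiber_section_ge0.
- by move=> t; apply: integral_ge0 => x _; exact: fiber_section_ge0.
- move=> t; apply: eq_integral => x _; congr fiber_measure.
  by apply/seteqP; split=> y /=; rewrite proj_addr_t.
Qed.

End Sections.

Lemma continuous_coset_act (s : screw R) :
  continuous (fun m : coset_space (@int_lattice R) => coset_act m s).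
Proof.
apply/quotient_continuous.
rewrite (_ : _ \o _ = proj \o (fun x : screw R => (x * s)%g)); last first.
  by apply/funext => x; exact: coset_actE.
move=> x; apply: continuous_comp; last exact: coset_proj_continuous.
apply: (smooth_continuous (f := fun v : 'rV[R]_3 => screw_mul 1 1 v s)).
apply: (@smooth_screw_mul _ _ 1 1 id (fun=> s)) => j; first exact: smooth_coord.
exact: smooth_cst.
Qed.

(** Right translation by [s] adds a constant to t, and adds to x and y amounts depending on t alone.
    In the iterated integral over t, x, y it is therefore undone by translations of one circle
    variable at a time. *)
Lemma lattice_measure_invariant (s : screw R) (A : set M) : measurable A ->
  lattice_measure ((fun m : coset_space (@int_lattice R) => coset_act m s) @^-1` A) =
  lattice_measure A.
Proof.
move=> mA; pose c t : R := cos (pi * t)%R; pose d t : R := sin (pi * t)%R.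
have mAs : measurable ((fun m : M => coset_act m s : M) @^-1` A).
  rewrite -[X in measurable X]setTI.
  exact: (continuous_borel_measurable (@continuous_coset_act s)).
apply: (eq_trans (lattice_measureE mAs)).
apply: (eq_trans _ (esym (lattice_measureE mA))).
apply: (eq_trans _ (time_integral_translate mA (s ord0 i0))).
apply: eq_integral => t _.
apply: (eq_trans _ (fiber_integral_translate mA _
  (c t * s ord0 i1 - d t * s ord0 i2)%R)).
apply: eq_integral => x _.
rewrite -(fiber_section_translate mA _ _ (d t * s ord0 i1 + c t * s ord0 i2)%R).
congr fiber_measure; apply/seteqP; split=> y /=;
  by rewrite coset_actE screw_mulgE /screw_mul !vec3E !mul1r.
Qed.

Lemma int_lattice_is_lattice : is_lattice R (@int_lattice R).
Proof.
split; first exact: int_lattice_discrete.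
exists lattice_measure; split; first by rewrite /= lattice_measureT lte_fin.
exact: lattice_measure_invariant.
Qed.

End LatticeMeasure.

Theorem mainTheorem6 (R : realType) :
  exists (S : lieGroup R) (Gamma : subgroup S),
    [/\ connected [set: S], simply_connected R S, solvable_group S,
        is_lattice R Gamma &
        ~ parameter_rigid (coset_atlas Gamma) (@coset_act S Gamma) /\
        H1_coset_eq_H1_lie Gamma].
Proof.
exists screw_lie, int_lattice; split.
- exact: screw_connected.
- exact: screw_simply_connected.
- exact: screw_solvable.
- exact: int_lattice_is_lattice.
- by split; [exact: not_parameter_rigid|exact: H1_int_lattice].
Qed.
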